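(* Let $\mathcal{M}$ be a regular mesh of dimension $n\ge 1$. Let $\mathcal{M}^*$ be the generalized mesh representing $\mathcal{M}$, and let $(\partial\mathcal{M})^*$ be the generalized mesh representing $\partial\mathcal{M}$. Then the generalized meshes $\partial^*\mathcal{M}^*$ (the generalized boundary of $\mathcal{M}^*$) and $(\partial\mathcal{M})^*$ are equal up to a relabeling.
   Context: **Simplices and meshes.** An $n$-simplex is a set of $n+1$ affinely independent points of $\mathbb{R}^m$ (its vertices); $|S|$ is the convex hull of $S$; its facets are its subsets with $n$ elements (for $n\geq 1$; a $0$-simplex has no facets). An $n$-dimensional mesh $\mathcal{M}$ is a finite set of $n$-simplices (its elements) with vertices in $\mathbb{R}^m$ ($m\ge n$) such that $|K|\cap|K'|=|K\cap K'|$ for all $K,K'\in\mathcal{M}$ (with $|\emptyset|=\emptyset$). Put $|\mathcal{M}|=\bigcup_{K\in\mathcal{M}}|K|$. The mesh is regular if $|\mathcal{M}|$ is an $n$-manifold with or without boundary. $\partial\mathcal{M}$ is the set of facets of elements of $\mathcal{M}$ that are contained in exactly one element of $\mathcal{M}$. A mesh is non-branching if every facet is contained in at most two elements; a regular mesh is non-branching, and its boundary is again a regular mesh. **Generalized meshes.** An $n$-dimensional generalized mesh $\mathcal{M}^*$ consists of a vertex set $\mathcal{V}$, a finite set $\mathbf{K}$ of elements, a realization function $\mathcal{K}$ assigning to each $\mathbf{k}\in\mathbf{K}$ an $n$-simplex $\mathcal{K}(\mathbf{k})$ over $\mathcal{V}$ (not necessarily injectively), and an adjacency graph on the set of split facets,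 i.e. pairs $(F,\mathbf{k})$ with $\mathbf{k}\in\mathbf{K}$ and $F$ a facet of $\mathcal{K}(\mathbf{k})$, such that (i) every node has degree $0$ or $1$; (ii) if $(F,\mathbf{k})$ and $(F',\mathbf{k}')$ are joined by an edge, then $F=F'$ and $\mathbf{k}\neq\mathbf{k}'$. If $(F,\mathbf{k})$, $(F,\mathbf{k}')$ are joined, one writes $\mathbf{k}\overset{F}{\longleftrightarrow}\mathbf{k}'$ and $\mathcal{N}(\mathbf{k},F)=\mathbf{k}'$; if $(F,\mathbf{k})$ has degree $0$, $\mathcal{N}(\mathbf{k},F)=\perp$ and $(F,\mathbf{k})$ is a boundary split facet. **Generalized mesh representing a non-branching mesh $\mathcal{M}$.** Its vertex set is the set of vertices of $\mathcal{M}$, its elements are the elements of $\mathcal{M}$, its realization is the identity, and $K\overset{F}{\longleftrightarrow}K'$ iff $K\neq K'$ and $F=K\cap K'$ is a common facet of $K$ and $K'$. **Relabeling.** $\mathcal{M}^*_2$ is a relabeling of $\mathcal{M}^*_1$ if there is a bijection $\varphi:\mathbf{K}_{\mathcal{M}^*_1}\to\mathbf{K}_{\mathcal{M}^*_2}$ with $\mathcal{K}_{\mathcal{M}^*_1}=\mathcal{K}_{\mathcal{M}^*_2}\circ\varphi$ and $\mathbf{k}\overset{F}{\longleftrightarrow}\mathbf{k}'$ in $\mathcal{M}^*_1$ if and only if $\varphi(\mathbf{k})\overset{F}{\longleftrightarrow}\varphi(\mathbf{k}')$ in $\mathcal{M}^*_2$. **Generalized boundary.** For $n\ge 2$, given a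 boundary split facet $\mathbf{f}=(F,\mathbf{k})$ and a facet $S$ of $F$, set $F_0=F$, $\mathbf{k}_1=\mathbf{k}$; recursively let $F_i$ be the unique facet of $\mathcal{K}(\mathbf{k}_i)$ containing $S$ and distinct from $F_{i-1}$, and, if $\mathcal{N}(\mathbf{k}_i,F_i)\ne\perp$, let $\mathbf{k}_{i+1}=\mathcal{N}(\mathbf{k}_i,F_i)$. This stops at some $Q$ with $\mathcal{N}(\mathbf{k}_Q,F_Q)=\perp$; put $\mathcal{N}_b(\mathbf{f},S)=(F_Q,\mathbf{k}_Q)$. For $n\ge1$, $\partial^*\mathcal{M}^*$ is the $(n-1)$-dimensional generalized mesh with the same vertex set as $\mathcal{M}^*$, elements the boundary split facets of $\mathcal{M}^*$, realization $(F,\mathbf{k})\mapsto F$, and (if $n\ge2$) adjacency $\mathbf{f}\overset{S}{\longleftrightarrow}\mathbf{f}'$ iff $\mathcal{N}_b(\mathbf{f},S)=\mathbf{f}'$. *)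

(* Defs.v *)
From HB Require Import structures.
From mathcomp Require Import all_boot all_order all_algebra.
From mathcomp Require Import finmap.
From mathcomp Require Import all_classical all_reals all_analysis.

Set Implicit Arguments.
Unset Strict Implicit.
Unset Printing Implicit Defensive.
Import Order.TTheory GRing.Theory Num.Theory.
Import numFieldNormedType.Exports.
Local Open Scope ring_scope.

Section Simplices.
Variables (R : realType) (m : nat).
Implicit Types (A K F : {fset 'rV[R]_m}).

Definition affinely_independent A : Prop :=
  forall c : 'rV[R]_m -> R,
    \sum_(p <- A) c p = 0 -> \sum_(p <- A) c p *: p = 0 ->
    forall p, p \in A -> c p = 0.

Definition is_simplex (n : nat) A : Prop :=
  #|` A| = n.+1 /\ affinely_independent A.

(* |A|; the weights cannot sum to 1 when A is empty, so |fset0| = set0. *)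
Definition hull A : set 'rV[R]_m :=
  [set x | exists c : 'rV[R]_m -> R,
     [/\ forall p, p \in A -> 0 <= c p,
         \sum_(p <- A) c p = 1 &
         x = \sum_(p <- A) c p *: p]]%classic.

(* The condition F != fset0 expresses that a 0-simplex has no facets. *)
Definition is_facet F K : bool :=
  [&& F != fset0, (F `<=` K)%fset & #|` F|.+1 == #|` K|].

Definition facets K : {fset {fset 'rV[R]_m}} :=
  [fset F in fpowerset K | is_facet F K]%fset.

Lemma in_facets F K : (F \in facets K) = is_facet F K.
Proof.
rewrite !inE /= fpowersetE /is_facet.
by case: (F != fset0); rewrite ?andbF //=; case: (F `<=` K)%fset.
Qed.

Lemma sum_fsub (V : zmodType) F K (f : 'rV[R]_m -> V) : (F `<=` K)%fset ->
  \sum_(p <- K) (if p \in F then f p else 0) = \sum_(p <- F) f p.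
Proof.
move=> FK; rewrite -(big_fset_incl _ FK) /=.
  by rewrite big_seq [RHS]big_seq; apply: eq_bigr => p ->.
by move=> p _ /negbTE ->.
Qed.

Lemma affinely_independentS F K :
  (F `<=` K)%fset -> affinely_independent K -> affinely_independent F.
Proof.
move=> FK aK c c0 cp0 p pF.
have := aK (fun p => if p \in F then c p else 0).
rewrite sum_fsub // c0 => /(_ erefl).
have -> : \sum_(p <- K) (if p \in F then c p else 0) *: p
        = \sum_(p <- K) (if p \in F then c p *: p else 0).
  by apply: eq_bigr => q _; case: ifP => // _; rewrite scale0r.
rewrite sum_fsub // => /(_ cp0 p (fsubsetP FK _ pF)).
by rewrite pF.
Qed.

Lemma simplex_facet n F K :
  is_simplex n.+1 K -> is_facet F K -> is_simplex n F.
Proof.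
move=> [cK aK] /and3P[_ FK /eqP cF]; split; last exact: affinely_independentS FK aK.
by apply: succn_inj; rewrite cF cK.
Qed.

Lemma hullS F K : (F `<=` K)%fset -> (hull F `<=` hull K)%classic.
Proof.
move=> FK x [c [c0 c1 xE]]; exists (fun p => if p \in F then c p else 0); split.
- by move=> p _; case: ifP => // /c0.
- by rewrite sum_fsub.
- rewrite xE -(sum_fsub _ FK); apply: eq_bigr => p _.
  by case: ifP => // _; rewrite scale0r.
Qed.

Lemma hullI F F' K : affinely_independent K ->
  (F `<=` K)%fset -> (F' `<=` K)%fset ->
  (hull F `&` hull F' = hull (F `&` F')%fset)%classic.
Proof.
move=> aK FK F'K; apply/seteqP; split=> [x [[c [c0 c1 xE]] [d [_ d1 xE']]]|x xI].
  have FF'F : (F `&` F' `<=` F)%fset by apply: fsubsetIl.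
  have cd p : p \in K ->
      (if p \in F then c p else 0) = (if p \in F' then d p else 0).
    move=> pK; apply/eqP; rewrite -subr_eq0; apply/eqP; move: p pK.
    apply: (aK (fun p => (if p \in F then c p else 0) -
                         (if p \in F' then d p else 0))).
      by rewrite sumrB !sum_fsub // c1 d1 subrr.
    under eq_bigr do rewrite scalerBl.
    rewrite sumrB; apply/eqP; rewrite subr_eq0; apply/eqP.
    transitivity x.
      rewrite xE -(sum_fsub _ FK); apply: eq_bigr => p _.
      by case: ifP => // _; rewrite scale0r.
    rewrite xE' -(sum_fsub _ F'K); apply: eq_bigr => p _.
    by case: ifP => // _; rewrite scale0r.
  have c0' p : p \in F -> p \notin (F `&` F')%fset -> c p = 0.
    move=> pF; rewrite inE pF /= => /negbTE pF'.
    by have := cd _ (fsubsetP FK _ pF); rewrite pF pF'.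
  exists c; split.
  - by move=> p; rewrite inE => /andP[/c0].
  - by rewrite -c1; apply: big_fset_incl.
  - by rewrite xE; symmetry; apply: big_fset_incl => // p pF pI; rewrite c0' // scale0r.
by split; move: xI; apply: hullS; [apply: fsubsetIl | apply: fsubsetIr].
Qed.

End Simplices.

(* The half-space {y in R^n | y_0 >= 0}; it is all of R^0 when n = 0. *)
Definition half_space (R : realType) (n : nat) : set 'rV[R]_n :=
  [set y | forall i : 'I_n, i = 0%N :> nat -> 0 <= y ord0 i]%classic.

Definition homeomorphic (T U : topologicalType) (A : set T) (B : set U) : Prop :=
  exists (f : T -> U) (g : U -> T),
    [/\ (forall x, A x -> B (f x) /\ g (f x) = x),
        (forall y, B y -> A (g y) /\ f (g y) = y),
        {within A, continuous f} &
        {within B, continuous g}]%classic.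

(* X, with the subspace topology, is a topological n-manifold with or without
   boundary.  Hausdorffness and second countability are inherited from R^m. *)
Definition is_manifold (R : realType) (m n : nat) (X : set 'rV[R]_m) : Prop :=
  forall x, X x ->
    exists (U : set 'rV[R]_m) (V : set 'rV[R]_n),
      [/\ open U, U x, open V &
          homeomorphic (X `&` U) (@half_space R n `&` V)]%classic.

Record mesh (R : realType) (m n : nat) := Mesh {
  mesh_elts :> {fset {fset 'rV[R]_m}};
  mesh_dim : (n <= m)%N;
  mesh_simplex : forall K, K \in mesh_elts -> is_simplex n K;
  mesh_hullI : forall K K', K \in mesh_elts -> K' \in mesh_elts ->
    (hull K `&` hull K')%classic = hull (K `&` K')%fset
}.

Section Meshes.
Variables (R : realType) (m n : nat).
Implicit Types (M : mesh R m n).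

Definition mesh_support M : set 'rV[R]_m :=
  (\bigcup_(K in [set K | K \in mesh_elts M]) hull K)%classic.

Definition regular M : Prop := is_manifold n (mesh_support M).

Definition mesh_vertices M : set 'rV[R]_m :=
  [set p | exists2 K, K \in mesh_elts M & p \in K]%classic.

Definition mesh_facets M : {fset {fset 'rV[R]_m}} :=
  (\bigcup_(K <- mesh_elts M) facets K)%fset.

Lemma mesh_facetsP M F :
  reflect (exists2 K, K \in mesh_elts M & is_facet F K) (F \in mesh_facets M).
Proof.
apply: (iffP (bigfcupP _ _ _ _)) => [[K /andP[KM _]]|[K KM FK]].
  by rewrite in_facets => FK; exists K.
by exists K; rewrite ?in_facets // KM.
Qed.

Definition elts_containing M (F : {fset 'rV[R]_m}) : {fset {fset 'rV[R]_m}} :=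
  [fset K in mesh_elts M | (F `<=` K)%fset]%fset.

Definition non_branching M : bool :=
  all (fun F => #|` elts_containing M F| <= 2)%N (mesh_facets M).

Definition boundary_facets M : {fset {fset 'rV[R]_m}} :=
  [fset F in mesh_facets M | #|` elts_containing M F| == 1%N]%fset.

Lemma boundary_facetsP M F : F \in boundary_facets M ->
  exists2 K, K \in mesh_elts M & is_facet F K.
Proof. by rewrite !inE /= => /andP[/mesh_facetsP]. Qed.

End Meshes.

Section MeshBoundary.
Variables (R : realType) (m n : nat) (M : mesh R m n.+1).

Lemma mesh_boundary_simplex F : F \in boundary_facets M -> is_simplex n F.
Proof.
move=> /boundary_facetsP[K KM FK].
exact: simplex_facet (mesh_simplex KM) FK.
Qed.

Lemma mesh_boundary_hullI F F' :
  F \in boundary_facets M -> F' \in boundary_facets M ->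
  (hull F `&` hull F')%classic = hull (F `&` F')%fset.
Proof.
move=> /boundary_facetsP[K KM /and3P[_ FK _]].
move=> /boundary_facetsP[K' KM' /and3P[_ FK' _]].
have [_ aK] := mesh_simplex KM; have [_ aK'] := mesh_simplex KM'.
have sK : (K `&` K' `<=` K)%fset by apply: fsubsetIl.
have sK' : (K `&` K' `<=` K')%fset by apply: fsubsetIr.
have FI : (hull F `&` hull (K `&` K')%fset = hull (F `&` (K `&` K'))%fset)%classic.
  exact: hullI aK FK sK.
have FI' : (hull F' `&` hull (K `&` K')%fset = hull (F' `&` (K `&` K'))%fset)%classic.
  exact: hullI aK' FK' sK'.
have -> : (hull F `&` hull F' =
    (hull F `&` hull (K `&` K')%fset) `&` (hull F' `&` hull (K `&` K')%fset))%classic.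
  rewrite -(mesh_hullI KM KM'); apply/seteqP; split=> x.
    move=> [xF xF']; have xK := hullS FK xF; have xK' := hullS FK' xF'.
    by split; split.
  by move=> [[xF _] [xF' _]].
rewrite FI FI' (hullI (K := K) aK); first last.
- exact: fsubset_trans (fsubsetIr _ _) sK.
- exact: fsubset_trans (fsubsetIr _ _) sK.
congr hull; apply/fsetP => p; rewrite !inE.
apply/idP/idP => [/andP[/and3P[-> _ _] /and3P[-> _ _]] //|/andP[pF pF']].
by rewrite pF pF' (fsubsetP FK) // (fsubsetP FK').
Qed.

Definition mesh_boundary : mesh R m n :=
  Mesh (ltnW (mesh_dim M)) mesh_boundary_simplex mesh_boundary_hullI.

End MeshBoundary.

(* gm_adj is the adjacency graph; its nodes are the split facets (F, k). *)
Record gmesh (R : realType) (m n : nat) := GMesh {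
  gm_vertices : set 'rV[R]_m;
  gm_elt : finType;
  gm_real : gm_elt -> {fset 'rV[R]_m};
  gm_adj : rel ({fset 'rV[R]_m} * gm_elt);
  gm_simplex : forall k,
    is_simplex n (gm_real k) /\ forall p, p \in gm_real k -> gm_vertices p;
  gm_adj_split : forall x y, gm_adj x y ->
    is_facet x.1 (gm_real x.2) /\ is_facet y.1 (gm_real y.2);
  gm_adj_sym : symmetric gm_adj;
  gm_adj_deg : forall x y z, gm_adj x y -> gm_adj x z -> y = z;
  gm_adj_facet : forall x y, gm_adj x y -> x.1 = y.1 /\ x.2 != y.2
}.

Section Representation.
Variables (R : realType) (m n : nat) (M : mesh R m n).

Definition repr_adj : rel ({fset 'rV[R]_m} * mesh_elts M) :=
  fun x y => [&& x.1 == y.1, x.2 != y.2,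
                 x.1 == (val x.2 `&` val y.2)%fset,
                 is_facet x.1 (val x.2) & is_facet x.1 (val y.2)].

Lemma repr_adj_sym : symmetric repr_adj.
Proof.
suff H x y : repr_adj x y -> repr_adj y x by move=> x y; apply/idP/idP; apply: H.
move=> /and5P[/eqP xy1 xy2 xE fx fy]; apply/and5P; rewrite -xy1; split=> //.
  by rewrite eq_sym.
by rewrite fsetIC.
Qed.

Lemma repr_simplex (k : mesh_elts M) :
  is_simplex n (val k) /\ forall p, p \in val k -> mesh_vertices M p.
Proof.
split; first exact: mesh_simplex (valP k).
by move=> p pk; exists (val k) => //; apply: valP.
Qed.

Lemma repr_adj_split x y :
  repr_adj x y -> is_facet x.1 (val x.2) /\ is_facet y.1 (val y.2).
Proof. by move=> /and5P[/eqP <-]. Qed.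

Lemma repr_adj_facet x y : repr_adj x y -> x.1 = y.1 /\ x.2 != y.2.
Proof. by move=> /and5P[/eqP]. Qed.

Lemma repr_adj_deg : non_branching M ->
  forall x y z, repr_adj x y -> repr_adj x z -> y = z.
Proof.
move=> /allP nb [F k] [F1 k1] [F2 k2] /= /and5P[/= /eqP<- nk1 _ fk fk1].
move=> /and5P[/= /eqP<- nk2 _ _ fk2]; congr pair; apply/eqP/negPn/negP => nk12.
have /nb : F \in mesh_facets M.
  by apply/mesh_facetsP; exists (val k) => //; apply: valP.
apply/negP; rewrite -ltnNge.
have <- : #|` [fset val k; val k1; val k2]%fset| = 3%N.
  rewrite fsetUC cardfsU1 cardfs2 (inj_eq val_inj) nk1 !inE !(inj_eq val_inj).
  by rewrite !(eq_sym k2) (negbTE nk2) (negbTE nk12).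
apply: fsubset_leq_card; apply/fsubsetP => K; rewrite !inE -orbA.
case/or3P => /eqP->; apply/andP; split; try exact: fsvalP.
- by case/and3P: fk.
- by case/and3P: fk1.
- by case/and3P: fk2.
Qed.

Definition gmesh_of (nbM : non_branching M) : gmesh R m n :=
  GMesh repr_simplex repr_adj_split repr_adj_sym (repr_adj_deg nbM) repr_adj_facet.

End Representation.

(* G2 is a relabeling of G1; the vertex sets are not compared. *)
Definition is_relabeling (R : realType) (m n : nat) (G1 G2 : gmesh R m n) : Prop :=
  exists phi : gm_elt G1 -> gm_elt G2,
    [/\ bijective phi,
        (forall k, gm_real k = gm_real (phi k)) &
        (forall F k k', gm_adj (F, k) (F, k') = gm_adj (F, phi k) (F, phi k'))].

Section GeneralizedBoundary.
Variables (R : realType) (m n : nat) (G : gmesh R m n.+1).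
Local Notation point := 'rV[R]_m.
Implicit Types (S F : {fset point}) (k : gm_elt G).

(* N(k, F), with None standing for the symbol "bottom". *)
Definition gm_nbr k F : option (gm_elt G) :=
  [pick k' | gm_adj (F, k) (F, k')].

Definition split_facets : {fset {fset point} * gm_elt G} :=
  [fset ((F, k) : {fset point} * gm_elt G)
    | k : gm_elt G in gm_elt G, F : {fset point} in facets (gm_real k)]%fset.

Definition boundary_split_facets : {fset {fset point} * gm_elt G} :=
  [fset x in split_facets | gm_nbr x.2 x.1 == None]%fset.

(* F' is the (unique) facet of K(k) containing S and distinct from F. *)
Definition other_facet k S F F' : bool :=
  [&& is_facet F' (gm_real k), (S `<=` F')%fset & F' != F].

(* gm_turn S (F, k) (F', k') : the recursion around S, entering k_1 = k with
   F_0 = F, stops at (F_Q, k_Q) = (F', k').  When (F, k) is a boundary split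
   facet and S a facet of F, this means N_b((F, k), S) = (F', k'). *)
Inductive gm_turn S :
    {fset point} * gm_elt G -> {fset point} * gm_elt G -> Prop :=
| gm_turn_stop F k F' :
    other_facet k S F F' -> gm_nbr k F' = None -> gm_turn S (F, k) (F', k)
| gm_turn_step F k F' k' y :
    other_facet k S F F' -> gm_nbr k F' = Some k' ->
    gm_turn S (F', k') y -> gm_turn S (F, k) y.

Definition bdry_real (f : boundary_split_facets) : {fset point} := (val f).1.

Definition bdry_adj : rel ({fset point} * boundary_split_facets) :=
  fun x y => [&& x.1 == y.1, is_facet x.1 (bdry_real x.2) &
                 `[< gm_turn x.1 (val x.2) (val y.2) >]].

Lemma in_split_facets x : (x \in split_facets) = is_facet x.1 (gm_real x.2).
Proof.
case: x => F k /=; apply/imfset2P/idP => [[k' _ [F' F'k [-> ->]]]|Fk].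
  by rewrite -in_facets.
by exists k; rewrite ?inE //; exists F; rewrite ?in_facets.
Qed.

Lemma in_boundary_split_facets x : (x \in boundary_split_facets) =
  is_facet x.1 (gm_real x.2) && (gm_nbr x.2 x.1 == None).
Proof. by rewrite !inE /= in_split_facets. Qed.

Lemma gm_nbrP k F k' : (gm_nbr k F = Some k') <-> gm_adj (F, k) (F, k').
Proof.
rewrite /gm_nbr; case: pickP => [k1 a1|a0]; split=> //.
- by move=> [<-].
- by move=> a; have [->] := gm_adj_deg a1 a.
- by rewrite a0.
Qed.

Lemma gm_nbr_sym k F k' : gm_nbr k F = Some k' -> gm_nbr k' F = Some k.
Proof. by move=> /gm_nbrP; rewrite gm_adj_sym => /gm_nbrP. Qed.

Lemma gm_nbr_facet k F k' :
  gm_nbr k F = Some k' -> is_facet F (gm_real k') /\ k != k'.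
Proof.
move=> /gm_nbrP a; have [_ /= ->] := gm_adj_split a.
by have [_ /= ->] := gm_adj_facet a.
Qed.

Lemma is_facet_pred1 F (K : {fset point}) :
  is_facet F K -> exists2 p, p \in K & F = (K `\ p)%fset.
Proof.
move=> /and3P[_ FK /eqP cF].
have /cardfs1P[p pE] : #|` (K `\` F)%fset| == 1%N.
  by rewrite cardfsDS // -cF subSnn.
have : p \in (K `\` F)%fset by rewrite pE inE.
rewrite inE => /andP[_ pK]; exists p => //.
by rewrite -pE fsetDK.
Qed.

Lemma other_facet_uniq k S F F1 F2 : is_facet F (gm_real k) -> is_facet S F ->
  other_facet k S F F1 -> other_facet k S F F2 -> F1 = F2.
Proof.
set K := gm_real k => fF fS /and3P[fF1 S1 n1] /and3P[fF2 S2 n2].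
apply/eqP/negPn/negP => n12.
have [p pK Fp] := is_facet_pred1 fF.
have [p1 p1K F1p] := is_facet_pred1 fF1; have [p2 p2K F2p] := is_facet_pred1 fF2.
have np1 : p1 != p by apply: contra n1 => /eqP pp; rewrite Fp F1p pp.
have np2 : p2 != p by apply: contra n2 => /eqP pp; rewrite Fp F2p pp.
have np12 : p1 != p2 by apply: contra n12 => /eqP pp; rewrite F1p F2p pp.
have /and3P[_ FK /eqP cF] := fF; have /and3P[_ SF /eqP cS] := fS.
have SK : (S `<=` K)%fset := fsubset_trans SF FK.
have : (#|` [fset p; p1; p2]%fset| <= #|` (K `\` S)%fset|)%N.
  apply: fsubset_leq_card; apply/fsubsetP => q; rewrite !inE -orbA.
  case/or3P => /eqP->; rewrite ?pK ?p1K ?p2K andbT; apply/negP.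
  - by move=> /(fsubsetP SF); rewrite Fp !inE eqxx.
  - by move=> /(fsubsetP S1); rewrite F1p !inE eqxx.
  - by move=> /(fsubsetP S2); rewrite F2p !inE eqxx.
rewrite fsetUC cardfsU1 cardfs2 !inE (negbTE np2) (eq_sym p2) (negbTE np12).
rewrite eq_sym np1 /= cardfsDS //.
have -> : (#|` K| - #|` S| = 2)%N by rewrite -cF -cS -addn2 addKn.
by [].
Qed.

Lemma other_facet_sym k S F F' : is_facet F (gm_real k) -> (S `<=` F)%fset ->
  other_facet k S F F' -> other_facet k S F' F.
Proof.
by move=> fF SF /and3P[_ _ F'F]; apply/and3P; split; rewrite // eq_sym.
Qed.

Lemma other_facet_facet k S F F' : is_facet F (gm_real k) -> is_facet S F ->
  other_facet k S F F' -> is_facet F' (gm_real k) /\ is_facet S F'.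
Proof.
move=> /and3P[_ _ /eqP cF] /and3P[S0 _ /eqP cS] /and3P[fF' SF' _].
split=> //; apply/and3P; split=> //; rewrite cS.
by case/and3P: fF' => _ _ /eqP cF'; rewrite -eqSS cF cF'.
Qed.

Lemma gm_turn_uniq S x y z : is_facet x.1 (gm_real x.2) -> is_facet S x.1 ->
  gm_turn S x y -> gm_turn S x z -> y = z.
Proof.
move=> fx Sx t; elim: t fx Sx z => {x y} [F k F' o b|F k F' k' y o b t IH] fF fS z /= t'.
  inversion t' as [F1 k1 F1' o1 b1|F1 k1 F1' k1' y1 o1 b1 t1]; subst.
    by rewrite (other_facet_uniq fF fS o o1).
  by move: b1; rewrite -(other_facet_uniq fF fS o o1) b.
inversion t' as [F1 k1 F1' o1 b1|F1 k1 F1' k1' y1 o1 b1 t1]; subst.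
  by move: b1; rewrite -(other_facet_uniq fF fS o o1) b.
have [_ fS'] := other_facet_facet fF fS o; have [fF' _] := gm_nbr_facet b.
move: b1 t1; rewrite -(other_facet_uniq fF fS o o1) b => -[<-].
exact: IH.
Qed.

Lemma gm_turn_facet S x y : is_facet x.1 (gm_real x.2) -> is_facet S x.1 ->
  gm_turn S x y -> is_facet S y.1.
Proof.
move=> fx Sx t; elim: t fx Sx => {x y} [F k F' o b|F k F' k' y o b t IH] fF fS /=.
  by have [_] := other_facet_facet fF fS o.
have [_ fS'] := other_facet_facet fF fS o; have [fF' _] := gm_nbr_facet b.
exact: IH.
Qed.

Lemma gm_turn_rev S x y : is_facet x.1 (gm_real x.2) -> is_facet S x.1 ->
  gm_turn S x y -> gm_nbr x.2 x.1 = None -> gm_turn S y x.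
Proof.
move=> fx Sx t.
suff H y0 : (gm_nbr x.2 x.1 = None /\ y0 = x) \/
    (exists2 k0, gm_nbr x.2 x.1 = Some k0 & gm_turn S (x.1, k0) y0) ->
    gm_turn S y y0.
  by move=> b; apply: H; left.
elim: t fx Sx => {x y} [F k F' o b|F k F' k' y o b t IH] /= fF fS H;
    have /and3P[_ SF _] := fS; have o' := other_facet_sym fF SF o.
  case: H => [[bF ->]|[k0 bF t0]]; first exact: gm_turn_stop.
  exact: gm_turn_step t0.
have [_ fS'] := other_facet_facet fF fS o; have [fF' _] := gm_nbr_facet b.
apply: IH => //; right; exists k; first exact: gm_nbr_sym.
case: H => [[bF ->]|[k0 bF t0]]; first exact: gm_turn_stop.
exact: gm_turn_step t0.
Qed.

(* gm_turn with its length and without the stopping condition. *)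
Fixpoint gm_seg S (l : nat) (x y : {fset point} * gm_elt G) : Prop :=
  if l is l'.+1 then
    exists F k, [/\ other_facet x.2 S x.1 F, gm_nbr x.2 F = Some k &
                    gm_seg S l' (F, k) y]
  else y.2 = x.2 /\ other_facet x.2 S x.1 y.1.

Lemma gm_turn_seg S x y : gm_turn S x y -> exists l, gm_seg S l x y.
Proof.
elim=> {x y} [F k F' o b|F k F' k' y o b t [l sl]]; first by exists 0%N.
by exists l.+1, F', k'.
Qed.

Lemma gm_seg_rcons S l x y : is_facet x.1 (gm_real x.2) -> is_facet S x.1 ->
  gm_seg S l.+1 x y -> exists F k,
  [/\ gm_seg S l x (F, k), gm_nbr k F = Some y.2, other_facet y.2 S F y.1,
      is_facet F (gm_real y.2) & is_facet S F].
Proof.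
elim: l x => [|l IH] [F k] /= fF fS [F1 [k1 [oF b s]]];
    have [_ fS1] := other_facet_facet fF fS oF; have [fF1 _] := gm_nbr_facet b.
  by case: s => -> o1; exists F1, k.
have [F2 [k2 [s2 b2 o2 f2 S2]]] := IH (F1, k1) fF1 fS1 s.
by exists F2, k2; split=> //; exists F1, k1.
Qed.

Lemma gm_seg_neq S l x : is_facet x.1 (gm_real x.2) -> is_facet S x.1 ->
  ~ gm_seg S l x x.
Proof.
have [L] := ubnP l; elim: L l x => // L IH [|[|l] ] [F k] /= lL fF fS.
- by case=> _ /and3P[_ _]; rewrite eqxx.
- move=> [F1 [k1 [_ b [kE _]]]]; have [_] := gm_nbr_facet b.
  by rewrite kE eqxx.
move=> [F1 [k1 [oF b s]]].
have [_ fS1] := other_facet_facet fF fS oF; have [fF1 _] := gm_nbr_facet b.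
have [F2 [k2 [s2 /= b2 o2 f2 S2]]] := gm_seg_rcons (x := (F1, k1)) fF1 fS1 s.
have /and3P[_ SF2 _] := S2.
have E : F2 = F1 by apply: other_facet_uniq fF fS (other_facet_sym f2 SF2 o2) oF.
move: b2 s2; rewrite E => /gm_nbr_sym; rewrite b => -[<-].
by apply: IH => //; apply: ltnW.
Qed.

Lemma bsf_facet (f : boundary_split_facets) :
  is_facet (val f).1 (gm_real (val f).2) /\ gm_nbr (val f).2 (val f).1 = None.
Proof.
by have := valP f; rewrite /= in_boundary_split_facets => /andP[-> /eqP].
Qed.

Lemma bdry_simplex (f : boundary_split_facets) :
  is_simplex n (bdry_real f) /\ forall p, p \in bdry_real f -> gm_vertices G p.
Proof.
have [fF _] := bsf_facet f; have [sK vK] := gm_simplex (val f).2.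
split; first exact: simplex_facet sK fF.
by move=> p pf; apply: vK; case/and3P: fF => _ /fsubsetP + _; apply.
Qed.

Lemma bdry_adj_split x y : bdry_adj x y ->
  is_facet x.1 (bdry_real x.2) /\ is_facet y.1 (bdry_real y.2).
Proof.
move=> /and3P[/eqP <- fS /asboolP t]; split=> //.
by have [fF _] := bsf_facet x.2; apply: gm_turn_facet fF fS t.
Qed.

Lemma bdry_adj_sym : symmetric bdry_adj.
Proof.
suff H x y : bdry_adj x y -> bdry_adj y x by move=> x y; apply/idP/idP; apply: H.
move=> xy; have [_ fy] := bdry_adj_split xy.
have /and3P[/eqP xy1 fS /asboolP t] := xy.
have [fF bF] := bsf_facet x.2.
rewrite -xy1 in fy; rewrite /bdry_adj -xy1 eqxx fy /=.
by apply/asboolP; apply: gm_turn_rev.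
Qed.

Lemma bdry_adj_deg x y z : bdry_adj x y -> bdry_adj x z -> y = z.
Proof.
case: x y z => S f [S1 g] [S2 h] /and3P[/= /eqP <- fS /asboolP t].
move=> /and3P[/= /eqP <- _ /asboolP t']; congr pair; apply: val_inj.
by have [fF _] := bsf_facet f; apply: gm_turn_uniq fF fS t t'.
Qed.

Lemma bdry_adj_facet x y : bdry_adj x y -> x.1 = y.1 /\ x.2 != y.2.
Proof.
move=> /and3P[/eqP xy1 fS /asboolP t]; split=> //; apply/eqP => xy2.
move: t; rewrite -xy2 => /gm_turn_seg[l].
by have [fF _] := bsf_facet x.2; apply: gm_seg_neq.
Qed.

Definition gmesh_boundary : gmesh R m n :=
  GMesh bdry_simplex bdry_adj_split bdry_adj_sym bdry_adj_deg bdry_adj_facet.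

End GeneralizedBoundary.

(* Main.v *)
Require Import Defs.
From mathcomp Require Import all_boot all_order all_algebra ring lra.
From mathcomp Require Import finmap.
From mathcomp Require Import all_classical all_reals all_analysis.

(** The topological input is invariance of domain, which is derived from a mod 2
    discrete Stokes formula (Kuhn's lemma), via the Poincare-Miranda theorem.

    Near the barycenter of a facet F, two elements that contain F form an
    embedded ball of full dimension.  If the support embeds locally in a
    Euclidean space of the same dimension, this ball is a neighbourhood, so
    there is no third element: this is non-branching for M.  A chart of |M| maps
    the boundary facets into the hyperplane y_0 = 0, because otherwise a
    Euclidean ball would embed openly in a half-space through a boundary point;
    hence the support of the boundary embeds locally in R^n, and the boundary is
    non-branching by the same argument.

    Finally, the walk around S from a boundary facet F is injective, so it stops
    at another boundary facet through S; since at most two boundary facets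
    contain S, it is the one adjacent to F in the boundary mesh. *)

Set Implicit Arguments.
Unset Strict Implicit.
Unset Printing Implicit Defensive.
Import Order.TTheory GRing.Theory Num.Theory.
Import numFieldNormedType.Exports.
Local Open Scope ring_scope.

(** * Kuhn's lemma *)

(** [gmesh_of] takes a proof of non-branching, so the statement itself asserts two facts about
    manifolds, and they carry nearly all the work. That the boundary is again a manifold is never
    proved: [local_embedding_non_branching] only asks for a continuous injection into a space of the
    right dimension near each barycenter, and on the boundary a chart with coordinate 0 dropped is
    one. Working mod 2 frees Kuhn's lemma from signs, as an odd count already yields the wanted
    cube. Row vectors carry the maximum norm, so balls are cubes and fit grids directly. *)

Section Kuhn.
Variables (n p : nat).
Local Notation pt := {ffun 'I_n -> nat}.
Implicit Types (q r : pt) (i j : 'I_n) (f g : pt -> 'F_2) (J : {set 'I_n}).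

Lemma addF2 (x : 'F_2) : x + x = 0.
Proof. by rewrite -mulr2n -mulr_natr pchar_Fp_0 // mulr0. Qed.

Definition incr j q : pt := [ffun i => (q i + (i == j))%N].
Definition upd j k q : pt := [ffun i => if i == j then k else q i].

Lemma incrC i j q : incr i (incr j q) = incr j (incr i q).
Proof. by apply/ffunP => l; rewrite !ffunE addnAC. Qed.

Lemma updC i j k l q : i != j -> upd i k (upd j l q) = upd j l (upd i k q).
Proof.
move=> ij; apply/ffunP => h; rewrite !ffunE.
by case: (eqVneq h i) => // ->; rewrite (negbTE ij).
Qed.

Lemma incr_updC i j k q : i != j -> incr i (upd j k q) = upd j k (incr i q).
Proof.
move=> ij; apply/ffunP => h; rewrite !ffunE; case: (eqVneq h j) => // ->.
by rewrite eq_sym (negbTE ij) addn0.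
Qed.

Lemma incr_upd j k q : incr j (upd j k q) = upd j k.+1 q.
Proof.
by apply/ffunP => h; rewrite !ffunE; case: eqVneq; rewrite ?addn1 ?addn0.
Qed.

Definition fdiff j f q : 'F_2 := f (incr j q) + f q.

(* The coefficient, at the coordinate cube spanned by J, of the mod 2 cup
   product df_1 ... df_k of the discrete differentials of fs = [f_1; ...; f_k]. *)
Fixpoint cup J (fs : seq (pt -> 'F_2)) q : 'F_2 :=
  if fs is f :: gs then \sum_(j in J) fdiff j f q * cup (J :\ j) gs (incr j q)
  else 1.

(** Every unordered pair is counted twice, which is 0 in characteristic 2. *)
Lemma sum_sym J (h : 'I_n -> 'I_n -> 'F_2) : (forall i j, h i j = h j i) ->
  \sum_(i in J) \sum_(j in J :\ i) h i j = 0.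
Proof.
move=> hC.
have E : \sum_(i in J) \sum_(j in J :\ i) h i j =
         \sum_(i in J) \sum_(j in J | (j < i)%N) h i j +
         \sum_(i in J) \sum_(j in J | (i < j)%N) h i j.
  rewrite -big_split; apply: eq_bigr => i iJ /=.
  rewrite (bigID (fun j : 'I_n => (j < i)%N)) /=; congr (_ + _); apply: eq_bigl => j;
    rewrite !inE -val_eqE /=; case: (j \in J); rewrite ?andbF //=; case: ltngtP => //.
rewrite E [X in _ + X](exchange_big_dep (mem J)) /=; last by move=> i j _ /andP[].
rewrite [X in _ + X](_ : _ = \sum_(i in J) \sum_(j in J | (j < i)%N) h i j) ?addF2 //.
apply: eq_bigr => i iJ; apply: eq_big => [j|j _]; last exact: hC.
by rewrite iJ.
Qed.

(* d^2 = 0 *)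
Lemma cup_closed fs J q : \sum_(j in J) fdiff j (cup (J :\ j) fs) q = 0.
Proof.
elim: fs J q => [|f gs IH] J q /=; first by rewrite big1 // => j _; rewrite /fdiff addF2.
have C i j : J :\ i :\ j = J :\ j :\ i by rewrite !finset.setDDl finset.setUC.
(* The product rule splits each term into a second difference of [f], symmetric in i and j and so
   killed by [sum_sym], and a term for the induction hypothesis. *)
transitivity (\sum_(j in J) \sum_(i in J :\ j)
   (fdiff j (fdiff i f) q * cup (J :\ j :\ i) gs (incr i (incr j q)) +
    fdiff i f q * fdiff j (cup (J :\ j :\ i) gs) (incr i q))).
  apply: eq_bigr => j _; rewrite {1}/fdiff -big_split /=; apply: eq_bigr => i _.
  rewrite [in X in _ + X](_ : cup (J :\ j :\ i) gs (incr i q) =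
    fdiff j (cup (J :\ j :\ i) gs) (incr i q) +
    cup (J :\ j :\ i) gs (incr j (incr i q))); last first.
    by rewrite /fdiff addrAC addF2 add0r.
  rewrite (incrC j i).
  rewrite [fdiff j (fdiff i f) q]/fdiff; ring.
under eq_bigr do rewrite big_split.
rewrite big_split /= sum_sym ?add0r; last first.
  move=> i j; rewrite (C i j) (incrC i j); congr (_ * _).
  by rewrite /fdiff (incrC i j); ring.
rewrite (exchange_big_dep (mem J)) /=; last by move=> i j _; rewrite !inE => /andP[].
rewrite big1 // => i iJ.
rewrite (eq_bigl (mem (J :\ i))); last first.
  by move=> j; rewrite /= !inE iJ andbT andbC eq_sym.
under eq_bigr do rewrite C.
by rewrite -mulr_sumr IH mulr0.
Qed.

(** The remaining product is closed, so the whole product is a coboundary; this is the form to which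
    Stokes applies. *)
Lemma cup_leibniz J f gs q :
  cup J (f :: gs) q = \sum_(j in J) fdiff j (fun r => f r * cup (J :\ j) gs r) q.
Proof.
rewrite /=; transitivity (\sum_(j in J) (fdiff j (fun r => f r * cup (J :\ j) gs r) q
   + f q * fdiff j (cup (J :\ j) gs) q)).
  apply: eq_bigr => j _; rewrite /fdiff.
  set a := f _; set b := f q; set c := cup _ _ _; set d := cup _ _ q.
  have -> : (a + b) * c = (a + b) * c + (b * d + b * d) by rewrite addF2 addr0.
  by ring.
by rewrite big_split /= -mulr_sumr cup_closed mulr0 addr0.
Qed.

(** The cube at q spanned by J stays in the slice where coordinate j is fixed, so a function
    constant on that slice has zero differential there. *)
Lemma cup_const fs J q j c : j \notin J ->
  (exists2 k, (k < size fs)%N & forall r, r j = q j -> nth (fun=> 0) fs k r = c) ->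
  cup J fs q = 0.
Proof.
elim: fs J q => [|f gs IH] J q jJ [k kl gc] //=.
case: k kl gc => [_|k] /= => [fc|kl gc]; apply: big1 => i iJ;
    have ij : j != i by apply: contraNneq jJ => ->.
  by rewrite /fdiff !fc ?addF2 ?mul0r // ffunE (negbTE ij) addn0.
rewrite IH ?mulr0 //; first by rewrite !inE (negbTE jJ) andbF.
by exists k => // r rj; rewrite gc // rj ffunE (negbTE ij) addn0.
Qed.

(** An integral over the face through q in the directions [js]. Cubes are indexed by their lowest
    corner, hence the range below p. *)
Fixpoint boxsum (js : seq 'I_n) f q : 'F_2 :=
  if js is j :: js' then \sum_(k < p) boxsum js' f (upd j k q) else f q.

Lemma eq_boxsum js f g q :
  (forall r, (forall i, i \notin js -> r i = q i) -> f r = g r) ->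
  boxsum js f q = boxsum js g q.
Proof.
elim: js q => [|j js IH] q fg /=; first exact: fg.
apply: eq_bigr => k _; apply: IH => r rq; apply: fg => i.
by rewrite inE negb_or => /andP[/negbTE ij /rq ->]; rewrite ffunE ij.
Qed.

Lemma boxsum0 js q : boxsum js (fun=> 0) q = 0.
Proof. by elim: js q => //= j js IH q; rewrite big1. Qed.

Lemma boxsum_sum js J (h : 'I_n -> pt -> 'F_2) q :
  boxsum js (fun r => \sum_(j in J) h j r) q = \sum_(j in J) boxsum js (h j) q.
Proof.
elim: js q => //= j js IH q; rewrite exchange_big.
by apply: eq_bigr => k _; rewrite IH.
Qed.

Lemma boxsum_fdiff js j f q : j \notin js ->
  boxsum js (fdiff j f) q = fdiff j (boxsum js f) q.
Proof.
elim: js q => //= i js IH q; rewrite inE negb_or => /andP[ij jjs].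
rewrite /fdiff -big_split; apply: eq_bigr => k _.
by rewrite IH // /fdiff incr_updC.
Qed.

(** The sum telescopes in the direction j, and differences in j commute with sums in the other
    directions. *)
Lemma boxsum_stokes js j f q : uniq js -> j \in js ->
  boxsum js (fdiff j f) q =
  boxsum (rem j js) f (upd j p q) + boxsum (rem j js) f (upd j 0 q).
Proof.
elim: js q => //= i js IH q /andP[ijs ujs]; rewrite inE eq_sym.
case: (eqVneq i j) => [<- _|ij /= jjs].
  under eq_bigr do rewrite boxsum_fdiff // /fdiff incr_upd.
  elim: p => [|k IHk]; first by rewrite big_ord0 addF2.
  rewrite big_ord_recr /= IHk; set a := boxsum _ _ _; set b := boxsum _ _ _.
  set c := boxsum _ _ _; have -> : a + b + (c + a) = (a + a) + (c + b) by ring.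
  by rewrite addF2 add0r.
rewrite -big_split; apply: eq_bigr => k _; rewrite IH //=.
by rewrite !(updC _ _ _ ij).
Qed.

Lemma boxsum_neq0 js f q : boxsum js f q != 0 ->
  exists r, (forall i, i \in js -> (r i < p)%N) /\ f r != 0.
Proof.
suff H : boxsum js f q != 0 ->
  exists r, [/\ forall i, i \in js -> (r i < p)%N,
                forall i, i \notin js -> r i = q i & f r != 0].
  by move=> /H[r [rp _ fr]]; exists r.
elim: js q => [|j js IH] q /= bs; first by exists q.
have [k bk] : exists k : 'I_p, boxsum js f (upd j k q) != 0.
  apply/existsP; apply: contraNT bs; rewrite negb_exists => /forallP b0.
  by rewrite big1 // => k _; apply/eqP/negPn/b0.
have [r [rp rq fr]] := IH _ bk; exists r; split=> // i.
  rewrite inE; case/orP => [/eqP->|/rp//].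
  have [/rp//|/rq->] := boolP (j \in js); by rewrite ffunE eqxx.
by rewrite inE negb_or => /andP[/negbTE ij /rq ->]; rewrite ffunE ij.
Qed.

(** A nonzero term is a monotone path of edges of the cube along which the functions change value
    one after the other. *)
Lemma cup_neq0 fs J q : cup J fs q != 0 -> forall k, (k < size fs)%N ->
  exists r s : pt, (forall i, q i <= r i <= q i + (i \in J))%N /\
              (forall i, q i <= s i <= q i + (i \in J))%N /\
              nth (fun=> 0) fs k r != nth (fun=> 0) fs k s.
Proof.
elim: fs J q => //= f gs IH J q c k kl.
have [j /andP[jJ]] : exists j, (j \in J) &&
    (fdiff j f q * cup (J :\ j) gs (incr j q) != 0).
  apply/existsP; apply: contraNT c; rewrite negb_exists => /forallP b0.
  by rewrite big1 // => j jJ; have := b0 j; rewrite jJ /= negbK => /eqP.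
rewrite mulf_eq0 negb_or => /andP[d0 c0].
case: k kl => [_|k kl] /=.
  exists (incr j q), q; split; last first.
    split; last by apply: contraNneq d0; rewrite /fdiff => ->; rewrite addF2.
    by move=> i; rewrite leqnn leq_addr.
  move=> i; rewrite ffunE leq_addr leq_add2l.
  by case: (eqVneq i j) => [->|]; rewrite ?jJ.
have [r [s [rq [sq rs]]]] := IH _ _ c0 k kl; exists r, s.
have cell (t : pt) : (forall i, incr j q i <= t i <= incr j q i + (i \in J :\ j))%N ->
    forall i, (q i <= t i <= q i + (i \in J))%N.
  move=> tq i; have := tq i; rewrite !ffunE !inE; case: (eqVneq i j) => [->|_] /=.
    rewrite jJ addn0 => /andP[h ->]; rewrite andbT.
    exact: leq_trans (leq_addr _ _) h.
  by rewrite addn0.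
by split; [exact: cell|split=> //; exact: cell].
Qed.

Variable lab : 'I_n -> pt -> bool.
Hypothesis lab0 : forall j q, q j = 0%N -> ~~ lab j q.
Hypothesis labp : forall j q, q j = p -> lab j q.

Let flab j q : 'F_2 := (lab j q)%:R.

(** Induction on the dimension. Stokes moves the sum to the faces. On a face orthogonal to a later
    direction j the label of j is constant, which gives 0; the face [j1 = 0] has factor 0; the face
    [j1 = p] has factor 1 and leaves the same sum in one dimension less. *)
Lemma boxsum_cup js q : uniq js ->
  boxsum js (cup [set j in js] [seq flab j | j <- js]) q = 1.
Proof.
elim: js q => [|j1 js IH] q //; rewrite cons_uniq => /andP[j1js ujs].
have ujs' : uniq (j1 :: js) by rewrite /= j1js.
pose A j := cup ([set j in j1 :: js] :\ j) [seq flab j | j <- js].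
rewrite (eq_boxsum (g := fun r => \sum_(j in [set j in j1 :: js])
  fdiff j (fun r => flab j1 r * A j r) r)); last first.
  by move=> r _; rewrite map_cons cup_leibniz.
rewrite boxsum_sum (bigD1 j1) ?inE ?eqxx //.
set t := boxsum _ _ _; rewrite big1; last first.
  move=> j /andP[]; rewrite inE => jjs jj1; rewrite boxsum_stokes //.
  have A0 k : k = 0%N \/ k = p ->
      boxsum (rem j (j1 :: js)) (fun r => flab j1 r * A j r) (upd j k q) = 0.
    move=> k0p; rewrite -[RHS](boxsum0 (rem j (j1 :: js)) (upd j k q)).
    apply: eq_boxsum => r rq.
    have rj : r j = k by rewrite rq ?ffunE ?eqxx // mem_rem_uniqF.
    rewrite /A (@cup_const _ _ _ j (k == p)%:R) ?mulr0 ?inE ?eqxx //.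
    exists (index j js).
      by rewrite size_map index_mem; move: jjs; rewrite inE (negbTE jj1).
    have jjs' : j \in js by move: jjs; rewrite inE (negbTE jj1).
    move=> s; rewrite rj => sj; rewrite (nth_map j) ?index_mem // nth_index //.
    rewrite /flab; congr (_%:R); congr nat_of_bool.
    have [kp|kp] := eqVneq k p; first by rewrite labp // sj.
    by apply/negbTE/lab0; rewrite sj; case: k0p => // /eqP; rewrite (negbTE kp).
  by rewrite !A0 ?addr0; [|left|right].
rewrite [LHS]addr0 {}/t boxsum_stokes ?mem_head //= eqxx.
rewrite [X in _ + X](eq_boxsum (g := fun=> 0)) ?boxsum0 ?addr0; last first.
  move=> r rq; rewrite /flab (negbTE (lab0 _)) ?mul0r //.
  by rewrite rq // ffunE eqxx.
rewrite -[RHS](IH (upd j1 p q) ujs); apply: eq_boxsum => r rq.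
rewrite /flab labp ?mul1r; last by rewrite rq // ffunE eqxx.
rewrite /A (_ : _ :\ _ = [set j in js]) //.
apply/setP => i; rewrite !inE; case: eqVneq => //= ->.
by rewrite (negbTE j1js).
Qed.

Lemma kuhn : exists q : pt, forall i, (q i < p)%N /\
  exists r s : pt, [/\ forall j, (q j <= r j <= (q j).+1)%N,
                  forall j, (q j <= s j <= (q j).+1)%N, lab i r & ~~ lab i s].
Proof.
have := boxsum_cup [ffun=> 0%N] (enum_uniq 'I_n).
set fs := [seq flab j | j <- _]; move=> b1.
have [|q [qp cq]] := @boxsum_neq0 (enum 'I_n) (cup [set j in enum 'I_n] fs) [ffun=> 0%N].
  by rewrite b1 oner_eq0.
exists q => i; split; first by apply: qp; rewrite mem_enum.
have il : (index i (enum 'I_n) < size fs)%N by rewrite size_map index_mem mem_enum.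
have [r [s [rq [sq]]]] := cup_neq0 cq il.
have cell (t : pt) : (forall j, q j <= t j <= q j + (j \in [set j in enum 'I_n]))%N ->
    forall j, (q j <= t j <= (q j).+1)%N.
  by move=> tq j; have := tq j; rewrite !inE mem_enum addn1.
rewrite (nth_map i) ?index_mem ?mem_enum // nth_index ?mem_enum // /flab => rs.
have [lr|lr] := boolP (lab i r).
  exists r, s; split; [exact: cell|exact: cell|by []|].
  by apply: contraNN rs => ls; rewrite lr ls.
exists s, r; split; [exact: cell|exact: cell| |by []].
by apply: contraNT rs => ls; rewrite (negbTE lr) (negbTE ls).
Qed.

End Kuhn.

Local Open Scope classical_set_scope.

(** * Invariance of domain *)

Section RowNorm.
Variables (R : realType) (n : nat).
Implicit Types x y : 'rV[R]_n.

Lemma rV_coord_le x i : `|x ord0 i| <= `|x|.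
Proof.
rewrite [leRHS]/Num.norm /= mx_normrE.
exact: (le_bigmax _ (fun ij : 'I_1 * 'I_n => `|x ij.1 ij.2|) (ord0, i)).
Qed.

Lemma rV_norm_le x e : 0 <= e -> (forall i, `|x ord0 i| <= e) -> `|x| <= e.
Proof.
move=> e0 xe; rewrite [leLHS]/Num.norm /= mx_normrE; apply/bigmax_leP; split=> //.
by move=> [i j] _ /=; rewrite ord1.
Qed.

Lemma rV_norm_lt x e : 0 < e -> (forall i, `|x ord0 i| < e) -> `|x| < e.
Proof.
move=> e0 xe; rewrite [ltLHS]/Num.norm /= mx_normrE; apply/bigmax_ltP; split=> //.
by move=> [i j] _ /=; rewrite ord1.
Qed.

Lemma rV_norm_coord x : x != 0 -> exists i, `|x| = `|x ord0 i|.
Proof.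
move=> x0; have [|[i j] xE] := @mx_norm_neq0 _ _ _ x.
  by rewrite -[mx_norm x]/(`|x|) normr_eq0.
by exists j; rewrite [LHS]xE [i]ord1.
Qed.

Lemma compact_cube a e : compact [set x : 'rV[R]_n | `|x - a| <= e].
Proof.
apply: bounded_closed_compact.
  exists (`|a| + e); split; first by rewrite num_real.
  move=> M aM x /= xa; rewrite -(subrK a x); apply: (le_trans (ler_normD _ _)).
  by rewrite addrC (le_trans _ (ltW aM)) // lerD2l.
have -> : [set x : 'rV[R]_n | `|x - a| <= e] = closed_ball_ Num.norm a e.
  by apply/seteqP; split=> x /=; rewrite /closed_ball_ /= distrC.
exact: closed_closed_ball_.
Qed.

End RowNorm.

(** * Continuity on subsets in epsilon-delta form, and the Poincare-Miranda theorem *)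

Lemma near_norm_lt (R : realType) (V : normedModType R) (x : V) (d : R) :
  0 < d -> \forall y \near x, `|x - y| < d.
Proof. by move=> d0; apply/nbhs_normP; exists d. Qed.

Lemma within_continuousP (R : realType) (V W : normedModType R) (A : set V)
    (f : V -> W) :
  {within A, continuous f} <->
  (forall x, A x -> forall e : R, 0 < e -> exists2 d : R, 0 < d &
     forall y, A y -> `|x - y| < d -> `|f x - f y| < e).
Proof.
split=> [/subspace_continuousP fA x Ax e e0|fA].
  have /cvgrPdist_lt/(_ e e0)/nbhs_normP[d d0 dP] := fA x Ax.
  by exists d => // y Ay xy; apply: (dP y).
apply/subspace_continuousP => x Ax; apply/cvgrPdist_lt => e e0.
have [d d0 dP] := fA x Ax e e0; apply/nbhs_normP; exists d => // y xy Ay.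
exact: dP.
Qed.

(** Heine-Cantor. In the covering form of compactness, the point and the radius d vary together,
    which gives one radius for all of A. *)
Lemma uniform_within_continuous (R : realType) (V W : normedModType R) (A : set V)
    (f : V -> W) : compact A -> {within A, continuous f} ->
  forall e : R, 0 < e -> exists2 d : R, 0 < d &
     forall x y, A x -> A y -> `|x - y| < d -> `|f x - f y| < e.
Proof.
move=> /compact_near_coveringP cA /within_continuousP fA e e0.
pose P (d : R) x := forall y, A x -> A y -> `|x - y| < d -> `|f x - f y| < e.
have : \forall d \near 0^'+, A `<=` P d.
  apply: cA => x Ax; have e20 : 0 < e / 2 by rewrite divr_gt0.
  have [d d0 dP] := fA x Ax _ e20.
  have d20 : 0 < d / 2 by rewrite divr_gt0.
  near=> x' d'; move=> y Ax' Ay x'y.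
  have xx' : `|x - x'| < d / 2.
    by near: x'; exact: near_norm_lt.
  have d'd : d' < d / 2 by near: d'; apply: nbhs_right_lt; rewrite divr_gt0.
  have xy : `|x - y| < d.
    rewrite -(subrKA x') (splitr d); apply: (le_lt_trans (ler_normD _ _)).
    by rewrite ltrD // (lt_trans x'y).
  rewrite -(subrKA (f x)) (splitr e); apply: (le_lt_trans (ler_normD _ _)).
  rewrite ltrD //; last exact: dP.
  by rewrite distrC dP // (lt_trans xx') // ltr_pdivrMr // ltr_pMr // ltr1n.
move=> H; near (0 : R)^'+ => d; exists d => // x y Ax Ay.
by apply: (near H d).
Unshelve. all: by end_near. Qed.

(** Without a zero, compactness gives a scale at which near every point some coordinate of F has a
    strict constant sign; a cell from Kuhn's lemma, labelled by signs, contradicts this. *)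
Lemma poincare_miranda (R : realType) (n : nat) (F : 'rV[R]_n -> 'rV[R]_n) :
  {within [set x : 'rV[R]_n | `|x| <= 1], continuous F} ->
  (forall (x : 'rV[R]_n) i, `|x| <= 1 -> x ord0 i = -1 -> F x ord0 i <= 0) ->
  (forall (x : 'rV[R]_n) i, `|x| <= 1 -> x ord0 i = 1 -> 0 <= F x ord0 i) ->
  exists2 x : 'rV[R]_n, `|x| <= 1 & F x = 0.
Proof.
pose Q := [set x : 'rV[R]_n | `|x| <= 1].
move=> /(within_continuousP Q) cF Fn Fp; apply: contrapT => noz.
(* Taking r = s excludes a zero of coordinate i, so [P k y] says that this coordinate keeps one
   strict sign within 2/k of y, the step of the grid below. *)
pose P (k : nat) y := exists i, forall r s,
  Q r -> Q s -> `|y - r| <= 2 / k%:R -> `|y - s| <= 2 / k%:R ->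
  ~ (0 <= F r ord0 i /\ F s ord0 i <= 0).
have cQ : compact Q.
  by rewrite /Q; under eq_set do rewrite -[X in `|X|]subr0; exact: compact_cube.
have : \forall k \near \oo, Q `<=` P k.
  apply: (compact_near_coveringP _).1 => // x Qx.
  have [i Fi] : exists i, F x ord0 i != 0.
    apply/existsP; apply: contraT; rewrite negb_exists => /forallP F0; exfalso.
    apply: noz; exists x => //; apply/rowP => i; rewrite mxE.
    by apply/eqP/negPn/F0.
  have Fi0 : 0 < `|F x ord0 i| by rewrite normr_gt0.
  have [d d0 dF] := cF x Qx _ Fi0.
  have d20 : 0 < d / 2 by rewrite divr_gt0.
  near=> y k.
  have xy : `|x - y| < d / 2.
    by near: y; exact: (@near_norm_lt R 'rV[R]_n).
  have k2 : 2 / k%:R < d / 2.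
    have k0 : 0 < k%:R :> R by near: k; exact: nbhs_infty_gtr.
    rewrite ltr_pdivrMr // mulrC -ltr_pdivrMr //.
    by near: k; exact: nbhs_infty_gtr.
  exists i => r s Qr Qs yr ys [Fr Fs].
  have close z : Q z -> `|y - z| <= 2 / k%:R ->
      `|F x ord0 i - F z ord0 i| < `|F x ord0 i|.
    move=> Qz yz; have /(dF z Qz) : `|x - z| < d.
      rewrite -(subrKA y) (splitr d); apply: (le_lt_trans (ler_normD _ _)).
      by rewrite ltrD // (le_lt_trans yz).
    apply: le_lt_trans; have := rV_coord_le (F x - F z) i.
    by rewrite !mxE.
  have := close r Qr yr; have := close s Qs ys.
  move: Fr Fs; set a := F x _ _; set b := F r _ _; set c := F s _ _.
  by rewrite !ltr_norml; have [a0|a0] := ger0P a; lra.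
move=> H; near \oo => k.
have k0 : (0 < k)%N by near: k; exact: nbhs_infty_gt.
have k0R : 0 < k%:R :> R by rewrite ltr0n.
pose pt (q : {ffun 'I_n -> nat}) : 'rV[R]_n := \row_i (-1 + 2 / k%:R * (q i)%:R).
(* The sign of F, overridden on the two opposite faces, where the weak inequalities [Fn] and [Fp]
   allow a zero. *)
pose lab (i : 'I_n) (q : {ffun 'I_n -> nat}) :=
  (q i == k) || (q i != 0)%N && (0 <= F (pt q) ord0 i).
have [||q qP] := @kuhn n k lab.
- by move=> j q qj; rewrite /lab qj eqxx (ltn_eqF k0).
- by move=> j q qj; rewrite /lab qj eqxx.
have Qpt (r : {ffun 'I_n -> nat}) : (forall j, r j <= k)%N -> Q (pt r).
  move=> rk; rewrite /Q /=; apply: rV_norm_le => // i; rewrite mxE ler_norml.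
  rewrite lerDl mulr_ge0 ?divr_ge0 //=.
  rewrite mulrAC -lerBrDl opprK ler_pdivrMr // ler_pM2l // ler_nat; exact: rk.
have [i] : P k (pt q).
  have : Q `<=` P k by near: k.
  by apply; apply: Qpt => j; have [/ltnW] := qP j.
have [qi [r [s [rq sq lr ls]]]] := qP i.
have cellQ (t : {ffun 'I_n -> nat}) : (forall j, q j <= t j <= (q j).+1)%N -> Q (pt t).
  move=> tq; apply: Qpt => j; have /andP[_ h] := tq j.
  by apply: leq_trans h _; have [] := qP j.
have cell (t : {ffun 'I_n -> nat}) : (forall j, q j <= t j <= (q j).+1)%N ->
    `|pt q - pt t| <= 2 / k%:R.
  move=> tq; apply: rV_norm_le => [|j]; first by rewrite divr_ge0.
  rewrite !mxE; have /andP[h1 h2] := tq j.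
  have -> : -1 + 2 / k%:R * (q j)%:R - (-1 + 2 / k%:R * (t j)%:R) =
            2 / k%:R * ((q j)%:R - (t j)%:R) :> R by ring.
  rewrite normrM ger0_norm ?divr_ge0 // ler_piMr ?divr_ge0 //.
  rewrite distrC ger0_norm ?subr_ge0 ?ler_nat // lerBlDr addrC natr1 ler_nat //.
move=> /(_ (pt r) (pt s) (cellQ _ rq) (cellQ _ sq) (cell _ rq) (cell _ sq)); apply.
split.
  move: lr; rewrite /lab; case: eqP => [rk _|_ /andP[]//].
  apply: Fp; first exact: cellQ.
  by rewrite mxE rk divfK ?gt_eqF //; lra.
move: ls; rewrite /lab negb_or negb_and negbK => /andP[_ /orP[/eqP s0|]].
  by apply: Fn; [exact: cellQ|rewrite mxE s0 mulr0 addr0].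
by rewrite -ltNge => /ltW.
Unshelve. all: by end_near. Qed.

(* The approximation is the infimal convolution of G with a steep cone. *)
Lemma lipschitz_approx (R : realType) (V : normedModType R) (Q : set V)
    (G : V -> R^o) (e : R) : Q !=set0 -> compact Q -> {within Q, continuous G} ->
  (forall x, Q x -> `|G x| <= 1) -> 0 < e ->
  exists (P : V -> R) (L : R), [/\ 0 < L,
    forall x y, `|P x - P y| <= L * `|x - y| &
    forall x, Q x -> `|P x - G x| <= e].
Proof.
move=> Q0 cQ cG G1 e0; have [d d0 dG] := uniform_within_continuous cQ cG e0.
(* Beyond distance d the cone rises by at least 2, the largest possible oscillation of G; only
   points within d compete, and there G varies by less than e. *)
pose L := 2 / d; have L0 : 0 < L by rewrite divr_gt0.
pose cone y := [set (G z : R) + L * `|y - z| | z in Q].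
have lb y : lbound (cone y) (-1).
  move=> _ [z Qz <-]; have := G1 z Qz; rewrite ler_norml => /andP[g _].
  by rewrite (le_trans g) // lerDl mulr_ge0 // ltW.
have hi y : has_inf (cone y).
  split; last by exists (-1).
  by case: Q0 => z Qz; exists ((G z : R) + L * `|y - z|); exists z.
exists (fun y => inf (cone y)), L; split=> //.
  suff H x y : inf (cone x) <= inf (cone y) + L * `|x - y|.
    move=> x y /=; have := H x y; have := H y x; rewrite (distrC y) ler_norml.
    by move: (inf _) (inf _) (L * _) => a b t; lra.
  rewrite -lerBlDr; apply: lb_le_inf; first by case: (hi y).
  move=> _ [z Qz <-]; rewrite lerBlDr.
  apply: (@le_trans _ _ (G z + L * `|x - z|)).
    by apply: ge_inf; [case: (hi x)|exists z].
  rewrite -addrA lerD2l -mulrDr ler_pM2l // [leRHS]addrC -(subrKA y x (- z)).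
  exact: ler_normD.
move=> x Qx; have Gx := G1 x Qx; rewrite ler_norml; apply/andP; split; last first.
  apply: (@le_trans _ _ 0); last exact: ltW.
  rewrite subr_le0; apply: ge_inf; first by case: (hi x).
  by exists x => //; rewrite subrr normr0 mulr0 addr0.
rewrite lerBrDl; apply: lb_le_inf; first by case: (hi x).
move=> _ [z Qz <-]; have Gz := G1 z Qz.
have [xz|xz] := ltP `|x - z| d.
  have := dG x z Qx Qz xz; rewrite ltr_norml => /andP[_ h].
  have : 0 <= L * `|x - z| by rewrite mulr_ge0 // ltW.
  move: h; set t := L * _; move: (G x : R) (G z : R) => a b; lra.
have : 2 <= L * `|x - z|.
  by rewrite /L mulrAC ler_pdivlMr // ler_pM2l.
move: Gx Gz; rewrite !ler_norml; set t := L * _.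
by move: (G x : R) (G z : R) => a b; lra.
Qed.

Lemma unit_bin (R : realType) (N : nat) (t : R) : (0 < N)%N -> 0 <= t <= 1 ->
  exists k : 'I_N, k%:R <= t * N%:R <= k%:R + 1.
Proof.
case: N => // N _ /andP[t0 t1].
have tN0 : 0 <= t * N.+1%:R by rewrite mulr_ge0.
have [kN|Nk] := ltnP (Num.truncn (t * N.+1%:R)) N.+1.
  exists (Ordinal kN) => /=; have /andP[h1 h2] := truncn_itv tN0.
  by rewrite h1 /= natr1 ltW.
(* Only t = 1 arrives here; the last bin is closed on the right. *)
exists ord_max => /=; have /andP[h1 _] := truncn_itv tN0.
rewrite natr1 ler_piMl // andbT (le_trans _ h1) // ler_nat.
exact: ltnW.
Qed.

(* Cut the sphere into O(N^n) cells of diameter O(1/N): by pigeonhole, their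
   images miss some point of a grid of order N^(n+1) that is fine enough. *)
Lemma lipschitz_sphere_avoids (R : realType) (n : nat)
    (P : 'rV[R]_n.+1 -> 'rV[R]_n.+1) (L eps eta : R) (c : 'rV[R]_n.+1) :
  0 < L -> 0 < eps -> 0 < eta ->
  (forall x y, `|P x - P y| <= L * `|x - y|) ->
  exists w : 'rV[R]_n.+1, `|w| <= eta /\
    forall y : 'rV[R]_n.+1, `|y - c| = eps -> P y != w.
Proof.
move=> L0 eps0 eta0 PL; apply: contrapT => H.
have {}H (w : 'rV[R]_n.+1) : `|w| <= eta ->
    exists y : 'rV[R]_n.+1, `|y - c| = eps /\ P y = w.
  move=> weta; apply: contrapT => nh; apply: H; exists w; split=> // y yc.
  by apply/eqP => Py; apply: nh; exists y.
(* Points in one cell are within 2 eps/N, so their images are within 2 L eps/N; with N = k M this is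
   less than the grid step 2 eta/M. *)
pose k := (Num.truncn (L * eps / eta)).+1.
have kP : L * eps < eta * k%:R.
  by rewrite (mulrC eta) -ltr_pdivrMr // truncnS_gt.
(* There are M^(n+1) grid points and 2 (n+1) N^n cells; this M makes the former more numerous. *)
pose M := (n.+1 * 2 * k ^ n).+1; pose N := (k * M)%N.
have N0 : (0 < N)%N by rewrite muln_gt0.
have M0R : 0 < M%:R :> R by rewrite ltr0n.
pose w (al : {ffun 'I_n.+1 -> 'I_M}) : 'rV[R]_n.+1 :=
  \row_i (- eta + 2 * eta / M%:R * (al i)%:R).
have weta al : `|w al| <= eta.
  apply: rV_norm_le => [|i]; first exact: ltW.
  rewrite mxE ler_norml lerDl mulr_ge0 ?divr_ge0 ?mulr_ge0 ?(ltW eta0) //=.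
  rewrite -lerBrDl opprK mulrAC ler_pdivrMr //.
  have -> : eta + eta = 2 * eta by ring.
  by rewrite ler_pM2l ?mulr_gt0 // ler_nat ltnW.
have [y yP] := choice (fun al => H _ (weta al)).
(* A cell is a face of the cubical sphere, given by an axis and a sign, with a bin for each of the n
   other coordinates. *)
pose T := ('I_n.+1 * bool * {ffun 'I_n -> 'I_N})%type.
pose cell (t : T) (z : 'rV[R]_n.+1) :=
  [/\ `|z ord0 t.1.1 - c ord0 t.1.1| = eps,
      t.1.2 = (0 <= z ord0 t.1.1 - c ord0 t.1.1) &
      forall j : 'I_n, (t.2 j)%:R <=
        (z ord0 (lift t.1.1 j) - c ord0 (lift t.1.1 j) + eps) / (2 * eps) * N%:R
        <= (t.2 j)%:R + 1].
have cellE al : exists t, cell t (y al).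
  have [yc _] := yP al.
  have [i yi] : exists i, `|y al - c| = `|(y al - c) ord0 i|.
    by apply: rV_norm_coord; rewrite -normr_gt0 yc.
  have bin (j : 'I_n) : exists h : 'I_N, h%:R <=
      (y al ord0 (lift i j) - c ord0 (lift i j) + eps) / (2 * eps) * N%:R <= h%:R + 1.
    apply: unit_bin => //; have := rV_coord_le (y al - c) (lift i j).
    rewrite yc !mxE; set a := _ - _; rewrite ler_norml => /andP[h1 h2].
    rewrite divr_ge0 ?mulr_ge0 ?(ltW eps0) //; last by rewrite -lerBlDr sub0r.
    by rewrite ler_pdivrMr ?mulr_gt0 // mul1r mulr_natl mulr2n lerD2r.
  have [g gP] := choice bin.
  exists (i, 0 <= y al ord0 i - c ord0 i, [ffun j => g j]); split=> //=.
    by rewrite -yc yi !mxE.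
  by move=> j; rewrite ffunE.
have [t tP] := choice cellE.
have t_inj : injective t.
  move=> al be tab; apply/eqP/negPn/negP => abE.
  have yy : `|y al - y be| <= 2 * eps / N%:R.
    apply: rV_norm_le => [|l]; first by rewrite divr_ge0 // mulr_ge0 // ltW.
    have := tP al; have := tP be; rewrite -tab /cell.
    move: (t al) => [[i b] g] /= [be1 be2 be3] [al1 al2 al3]; rewrite !mxE.
    have [->|li] := eqVneq l i.
      have -> : y al ord0 i - y be ord0 i = 0; last first.
        by rewrite normr0 divr_ge0 // mulr_ge0 // ltW.
      have : (0 <= y al ord0 i - c ord0 i) = (0 <= y be ord0 i - c ord0 i).
        by rewrite -al2 -be2.
      move: al1 be1; have -> : y al ord0 i - y be ord0 i =
        (y al ord0 i - c ord0 i) - (y be ord0 i - c ord0 i) by ring.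
      set u := y al _ _ - _; set v := _ - _.
      by case: (ger0P u); case: (ger0P v) => // h1 h2 e1 e2 _; lra.
    rewrite eq_sym in li; have [j -> _] := unlift_some li.
    have := al3 j; have := be3 j.
    set a := y al _ _; set b' := y be _ _; set d := c _ _ => h1 h2.
    have : `|(a - d + eps) / (2 * eps) * N%:R - (b' - d + eps) / (2 * eps) * N%:R| <= 1.
      move: h1 h2; set u := _ * _; set v := _ * _; move: (g j)%:R => x.
      by rewrite ler_norml; lra.
    have -> : (a - d + eps) / (2 * eps) * N%:R - (b' - d + eps) / (2 * eps) * N%:R =
              (a - b') / ((2 * eps) / N%:R).
      by field; rewrite pnatr_eq0 -lt0n N0 gt_eqF.
    have z0 : 0 < 2 * eps / N%:R by rewrite divr_gt0 ?mulr_gt0 ?ltr0n.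
    by rewrite normrM normfV (gtr0_norm z0) ler_pdivrMr // mul1r.
  have [i /eqP abi] : exists i, al i != be i.
    apply/existsP; apply: contraNT abE; rewrite negb_exists => /forallP h.
    by apply/eqP/ffunP => i; apply/eqP/negPn.
  have ww : `|w al - w be| <= L * (2 * eps / N%:R).
    rewrite -(yP al).2 -(yP be).2; apply: (le_trans (PL _ _)).
    by rewrite ler_pM2l.
  have := le_trans (rV_coord_le (w al - w be) i) ww; rewrite !mxE.
  have -> : - eta + 2 * eta / M%:R * (al i)%:R - (- eta + 2 * eta / M%:R * (be i)%:R) =
     2 * eta / M%:R * ((al i)%:R - (be i)%:R) by ring.
  rewrite normrM ger0_norm; last by rewrite divr_ge0 // mulr_ge0 // ltW.
  have ab1 : 1 <= `|(al i)%:R - (be i)%:R : R|.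
    have [h|h|h] := ltngtP (al i) (be i).
    - by rewrite distrC ger0_norm ?subr_ge0 ?ler_nat 1?ltnW // lerBrDr nat1r ler_nat.
    - by rewrite ger0_norm ?subr_ge0 ?ler_nat 1?ltnW // lerBrDr nat1r ler_nat.
    - by case: abi; apply: val_inj.
  move=> /(le_trans _) => /(_ (2 * eta / M%:R)); rewrite ler_peMr //; last first.
    by rewrite divr_ge0 // mulr_ge0 // ltW.
  move=> /(_ isT); rewrite leNgt => /negP; apply.
  rewrite /N natrM mulrA ltr_pdivrMr ?mulr_gt0 //.
  have -> : 2 * eta / M%:R * (k%:R * M%:R) = 2 * (eta * k%:R).
    by field; rewrite gt_eqF.
  by rewrite mulrCA ltr_pM2l.
have := leq_card t t_inj; rewrite !card_prod card_bool !card_ffun !card_ord.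
rewrite expnS /N expnMn mulnA leq_pmul2r ?expn_gt0 //.
by rewrite ltnn.
Qed.

Lemma continuousP_norm (R : realType) (V W : normedModType R) (f : V -> W) (x : V) :
  {for x, continuous f} -> forall e : R, 0 < e -> exists2 d : R, 0 < d &
     forall y, `|x - y| < d -> `|f x - f y| < e.
Proof.
by move=> /cvgrPdist_lt fx e /fx/nbhs_normP[d d0 dP]; exists d => // y; apply: dP.
Qed.

(** The image of K minus a ball around x is compact, hence closed, and by injectivity it misses
    [f x]. *)
Lemma inverse_within_continuous (R : realType) (V W : normedModType R) (K : set V)
    (f : V -> W) (g : W -> V) : compact K -> {within K, continuous f} ->
  (forall x, K x -> g (f x) = x) -> {within f @` K, continuous g}.
Proof.
move=> cK cf gf; apply/within_continuousP => _ [x Kx <-] e e0.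
pose C := K `&` ~` [set z | `|x - z| < e].
have oB : open [set z | `|x - z| < e].
  suff -> : [set z | `|x - z| < e] = ball x e by exact: ball_open.
  by rewrite -ball_normE.
have cC : compact C by apply: compact_closedI => //; exact: open_closedC.
have cfC : closed (f @` C).
  apply: compact_closed; first exact: norm_hausdorff.
  apply: continuous_compact cC; move/subspace_continuousP: cf => cf.
  apply/subspace_continuousP => z [Kz _]; apply: cvg_trans (cf z Kz).
  by apply: cvg_app; apply: within_subset => z' [].
have : (~` (f @` C)) (f x).
  move=> [z [Kz /= nz] fzx]; apply: nz.
  by rewrite -(gf z Kz) fzx gf // subrr normr0.
have : open (~` (f @` C)) by exact: closed_openC.
rewrite openE => oC /oC /nbhs_normP[d d0 dP].
exists d => // _ [z Kz <-] fxz; rewrite !gf //.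
by apply: contrapT => nz; apply: (dP (f z) fxz); exists z.
Qed.

(** The factor is max(1, eps/|z - c|), written as (a + b + |a - b|)/2: the map pushes the punctured
    ball of radius eps onto its sphere and fixes the outside. *)
Lemma radial_continuous (R : realType) (V : normedModType R) (c y : V) (eps : R) :
  y != c -> {for y, continuous (fun z : V =>
    c + ((1 + eps / `|z - c| + `|1 - eps / `|z - c| |) / 2) *: (z - c))}.
Proof.
move=> yc; have cB : {for y, continuous (fun z : V => z - c)}.
  by apply: continuousB; [exact: cvg_id|exact: cvg_cst].
have cN : {for y, continuous (fun z : V => (eps / `|z - c| : R^o))}.
  apply: (@continuousM R); first exact: cvg_cst.
  apply: (@continuousV R _ (fun z : V => `|z - c|)).
    by rewrite normr_eq0 subr_eq0.
  exact: (cvg_norm cB).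
apply: continuousD; first exact: cvg_cst.
apply: (@continuousZ R); last exact: cB.
apply: (@continuousM R); last exact: cvg_cst.
apply: (@continuousD R R^o).
  by apply: (@continuousD R R^o); [exact: cvg_cst|exact: cN].
have cB1 : {for y, continuous (fun z : V => (1 - eps / `|z - c| : R^o))}.
  by apply: (@continuousB R R^o); [exact: cvg_cst|exact: cN].
exact: (cvg_norm cB1).
Qed.

(* If f 0 is not interior to the image, then a continuous extension of the
   inverse of f can be perturbed, by a radial push away from a missed point c
   near f 0, into a map without zero on the image and close to the inverse; its
   composite with f then contradicts the Poincare-Miranda theorem. *)
Lemma invariance_of_domain_unit (R : realType) (n : nat)
    (f : 'rV[R]_n.+1 -> 'rV[R]_n.+1) :
  {within [set x : 'rV[R]_n.+1 | `|x| <= 1], continuous f} ->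
  (forall x y : 'rV[R]_n.+1, `|x| <= 1 -> `|y| <= 1 -> f x = f y -> x = y) ->
  exists2 d : R, 0 < d & forall y : 'rV[R]_n.+1, `|y - f 0| < d ->
    exists2 x : 'rV[R]_n.+1, `|x| <= 1 & f x = y.
Proof.
move=> cf fI; pose V : normedModType R := 'rV[R]_n.+1.
pose Q := [set x : V | `|x| <= 1]; pose K : set V := f @` Q.
have cQ : compact Q.
  by rewrite /Q; under eq_set do rewrite -[X in `|X|]subr0; exact: compact_cube.
have cK : compact K by exact: (@continuous_compact V V).
have Q0 : Q 0 by rewrite /Q /= normr0.
apply: contrapT => nd.
have {}nd d : 0 < d -> exists2 c : V, `|c - f 0| < d & ~ K c.
  move=> d0; apply: contrapT => h; apply: nd; exists d => // y yd.
  by apply: contrapT => h'; apply: h; exists y => // -[x Qx fx]; apply: h'; exists x.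
pose g y := xget 0 [set x | Q x /\ f x = y].
have gf x : Q x -> g (f x) = x.
  move=> Qx; have [] : (Q (g (f x)) /\ f (g (f x)) = f x).
    by apply: (@xgetPex _ 0 [set z | Q z /\ f z = f x]); exists x.
  by move=> Qg fg; apply: fI.
have cg : {within K, continuous g} by exact: (@inverse_within_continuous R V V).
have tietze i : exists G : V -> R^o, [/\ continuous G,
    (forall y, K y -> G y = g y ord0 i) & forall y, `|G y| <= 1].
  have [|||||G [GE cG G1]] := @continuous_bounded_extension V R _ K _
      (fun y => g y ord0 i : R^o) 1.
  - exact: pseudometric_normal.
  - by apply: compact_closed cK; exact: norm_hausdorff.
  - exact: ltr01.
  - apply/(@within_continuousP R V R^o) => y Ky e e0.
    have [d d0 dP] := (@within_continuousP R V V K g).1 cg y Ky e e0.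
    exists d => // z Kz yz; apply: le_lt_trans (dP z Kz yz).
    by have := rV_coord_le (g y - g z) i; rewrite !mxE.
  - move=> _ [x Qx <-]; rewrite gf //; exact: le_trans (rV_coord_le _ _) Qx.
  - by exists G; split=> // y Ky; rewrite GE // inE.
have [G GP] := choice tietze.
have Gf i x : Q x -> G i (f x) = x ord0 i.
  by move=> Qx; have [_ GE _] := GP i; rewrite GE ?gf //; exists x.
(* Each [G i] vanishes at [f 0]. The radius 3 eps has room for the ball of radius eps around c,
   whose centre is within eps of [f 0]. *)
have [eps eps0 epsG] : exists2 eps : R, 0 < eps &
    forall y : V, `|f 0 - y| < 3 * eps -> forall i, `|G i y| < 10^-1.
  have : \forall y \near (f 0 : V), forall i, `|G i y| < 10^-1.
    apply: (@filter_forall V 'I_n.+1 (fun i y => `|G i y| < 10^-1) _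
      (nbhs_filter (f 0 : V))) => i.
    have [cG _ _] := GP i.
    have /cvgrPdist_lt/(_ 10^-1) := cG (f 0).
    have t0 : 0 < 10^-1 :> R by rewrite invr_gt0.
    move=> /(_ t0); apply: filterS => y.
    by rewrite Gf // mxE sub0r normrN.
  move=> /nbhs_normP[d d0 dP]; exists (d / 3); first by rewrite divr_gt0.
  by move=> y; rewrite mulrC divfK // => yd; apply: dP.
have [c cf0 nKc] := nd _ eps0.
(* Since |c - f 0| < eps, a small ball around 0 is sent into the ball around c; so where the push
   fixes [f x], x stays away from 0. *)
have [del [del0 del1 delP]] : exists del : R, [/\ 0 < del, del <= 10^-1 &
    forall x, Q x -> eps <= `|f x - c| -> del <= `|x|].
  have e0 : 0 < eps - `|c - f 0| by rewrite subr_gt0.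
  have [d d0 dP] := (within_continuousP Q f).1 cf 0 Q0 _ e0.
  exists (Num.min d 10^-1); split.
  - by rewrite lt_min d0 invr_gt0 ltr0n.
  - by rewrite ge_min lexx orbT.
  - move=> x Qx h; rewrite ge_min leNgt; apply/orP; left; apply/negP => xd.
    have := dP x Qx; rewrite sub0r normrN => /(_ xd).
    rewrite ltNge => /negP; apply; rewrite lerBlDr (le_trans h) //.
    by rewrite (distrC (f 0)) (distrC c) -(subrKA (f 0)) ler_normD.
(* The radial push sends K into this compact set, so the approximation has to be good there. *)
pose Q2 := K `|` [set y : V | `|y - c| <= eps].
have approx i : exists PL : (V -> R) * R, [/\ 0 < PL.2,
    (forall x y, `|PL.1 x - PL.1 y| <= PL.2 * `|x - y|) &
    forall x, Q2 x -> `|PL.1 x - G i x| <= del / 4].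
  have [cG _ G1] := GP i.
  have [|||||P [L [h1 h2 h3]]] := @lipschitz_approx R V Q2 (G i) (del / 4).
  - by exists (f 0); left; exists 0.
  - by apply: compactU => //; exact: compact_cube.
  - exact: continuous_subspaceT.
  - by move=> x _; exact: G1.
  - by rewrite divr_gt0.
  - by exists (P, L).
have [PL PLP] := choice approx.
pose P (y : V) : V := \row_i (PL i).1 y.
pose L := \sum_i (PL i).2.
have L0 : 0 < L.
  rewrite /L big_ord_recl ltr_pwDl //; first by case: (PLP ord0).
  by apply: sumr_ge0 => i _; have [/ltW] := PLP (lift ord0 i).
have PLip x y : `|P x - P y| <= L * `|x - y|.
  apply: rV_norm_le => [|i]; first by rewrite mulr_ge0 // ltW.
  rewrite !mxE; have [_ h _] := PLP i; apply: (le_trans (h x y)).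
  rewrite ler_wpM2r // /L (bigD1 i) //= lerDl.
  by apply: sumr_ge0 => j _; have [/ltW] := PLP j.
have d40 : 0 < del / 4 by rewrite divr_gt0.
have [w [wd wP]] := lipschitz_sphere_avoids c L0 eps0 d40 PLip.
pose Phi (z : V) : V :=
  c + ((1 + eps / `|z - c| + `|1 - eps / `|z - c| |) / 2) *: (z - c).
have Phi_out z : eps <= `|z - c| -> Phi z = z.
  move=> h; have zc : 0 < `|z - c| by exact: lt_le_trans h.
  rewrite /Phi ger0_norm ?subr_ge0 ?ler_pdivrMr ?mul1r //.
  rewrite (_ : _ / 2 = 1) ?scale1r ?subrKC //.
  by field; rewrite gt_eqF.
have Phi_in z : z != c -> `|z - c| <= eps -> `|Phi z - c| = eps.
  move=> zc h; have zc0 : 0 < `|z - c| by rewrite normr_gt0 subr_eq0.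
  rewrite /Phi ler0_norm ?subr_le0 ?ler_pdivlMr ?mul1r //.
  rewrite addrC addKr normrZ (_ : _ / 2 = eps / `|z - c|).
    by rewrite ger0_norm ?divfK ?gt_eqF // divr_ge0 // ltW.
  by field; rewrite gt_eqF.
have Kc z : K z -> z != c by move=> Kz; apply: contra_notN nKc => /eqP <-.
(* H has no zero x: if [f x] is outside the ball, H x is within del/2 of x while |x| >= del; if
   inside, [Phi (f x)] is on the sphere, where P misses w. *)
pose H x : V := P (Phi (f x)) - w.
have HE x i : H x ord0 i = (PL i).1 (Phi (f x)) - w ord0 i by rewrite !mxE.
have wi i : `|w ord0 i| <= del / 4 by exact: le_trans (rV_coord_le _ _) wd.
have Hout x i : Q x -> eps <= `|f x - c| -> `|H x ord0 i - x ord0 i| <= del / 2.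
  move=> Qx h; rewrite HE Phi_out // -Gf //; have [_ _ h2] := PLP i.
  have QK : Q2 (f x) by left; exists x.
  have := h2 _ QK; have := wi i; rewrite !ler_norml.
  by set a := _ (f x); set b := G i _; lra.
have Hin x i : Q x -> `|f x - c| <= eps -> `|H x ord0 i - x ord0 i| <= 1.
  move=> Qx h; have [_ _ h2] := PLP i.
  have Kfx : K (f x) by exists x.
  have Pc := Phi_in _ (Kc _ Kfx) h.
  have near z : `|z - c| <= eps -> `|G i z| < 10^-1.
    move=> zc; apply: epsG; rewrite -(subrKA c) (le_lt_trans (ler_normD _ _)) //.
    by rewrite (distrC (f 0)) (distrC c z); lra.
  have := near _ h; rewrite Gf // HE.
  have Q2P : Q2 (Phi (f x)) by right; rewrite /= Pc.
  have := near (Phi (f x)); rewrite Pc => /(_ (lexx _)).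
  have := h2 _ Q2P; have := wi i; rewrite !ler_norml !ltr_norml.
  by set a := _ (Phi _); set b := G i _; lra.
(* Staying within 1 of the identity gives H the signs on the faces that [poincare_miranda] asks
   for. *)
have H1 x i : Q x -> `|H x ord0 i - x ord0 i| <= 1.
  move=> Qx; have [h|/ltW h] := leP eps `|f x - c|; last exact: Hin.
  by apply: (le_trans (Hout x i Qx h)); lra.
have cH : {within Q, continuous H}.
  apply/within_continuousP => x Qx e e0.
  have Kfx : K (f x) by exists x.
  have eL0 : 0 < e / L by rewrite divr_gt0.
  have [d1 d10 d1P] := continuousP_norm
    (@radial_continuous R V c (f x) eps (Kc _ Kfx)) eL0.
  have [d d0 dP] := (within_continuousP Q f).1 cf x Qx _ d10.
  exists d => // y Qy xy; rewrite /H opprB addrA subrK.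
  apply: (le_lt_trans (PLip _ _)); rewrite mulrC -ltr_pdivlMr //.
  exact: d1P (dP y Qy xy).
have [||x Qx Hx] := poincare_miranda cH.
- by move=> x i Qx xi; have := H1 x i Qx; rewrite xi ler_norml; lra.
- by move=> x i Qx xi; have := H1 x i Qx; rewrite xi ler_norml; lra.
have Kfx : K (f x) by exists x.
have [h|/ltW h] := leP eps `|f x - c|.
  have xd := delP x Qx h.
  have [i xi] : exists i, `|x| = `|x ord0 i|.
    by apply: rV_norm_coord; rewrite -normr_gt0; exact: lt_le_trans xd.
  have := Hout x i Qx h; rewrite Hx mxE sub0r normrN -xi; lra.
have /eqP := wP _ (Phi_in _ (Kc _ Kfx) h); apply.
by apply/eqP; rewrite -subr_eq0; apply/eqP.
Qed.

(** * Continuity of affine expressions, and invariance of domain on arbitrary balls *)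

Lemma continuous_sum (R : realType) (V W : normedModType R) (I : Type) (s : seq I)
    (F : I -> V -> W) : (forall i, continuous (F i)) ->
  continuous (fun x => \sum_(i <- s) F i x).
Proof.
move=> cF; elim: s => [|i s IH].
  by under eq_fun do rewrite big_nil; move=> x; exact: cvg_cst.
under eq_fun do rewrite big_cons.
by move=> x; apply: continuousD; [exact: cF|exact: IH].
Qed.

Lemma continuous_row_sum (R : realType) (V W : normedModType R) (k : nat)
    (t : 'I_k -> V -> R) (a : 'I_k -> W) :
  (forall i, continuous (t i : V -> R^o)) -> continuous (fun x => \sum_i t i x *: a i).
Proof.
move=> ct; apply: continuous_sum => i x.
by apply: continuousZ; [exact: ct|exact: cvg_cst].
Qed.

Lemma continuous_coord (R : realType) (k : nat) (i : 'I_k) :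
  continuous (fun c : 'rV[R]_k => c ord0 i : R^o).
Proof. exact: coord_continuous. Qed.

Lemma continuous_mulmx (R : realType) (k l : nat) (B : 'M[R]_(k, l)) :
  continuous (fun c : 'rV[R]_k => c *m B).
Proof.
under eq_fun do rewrite mulmx_sum_row.
exact: (@continuous_row_sum R 'rV[R]_k 'rV[R]_l k (fun i c => c ord0 i) _
  (@continuous_coord R k)).
Qed.

Lemma within_continuous_comp (R : realType) (U V W : normedModType R)
    (A : set U) (B : set V) (f : U -> V) (g : V -> W) :
  {within A, continuous f} -> {within B, continuous g} ->
  (forall x, A x -> B (f x)) -> {within A, continuous (g \o f)}.
Proof.
move=> /within_continuousP cf /within_continuousP cg AB.
apply/within_continuousP => x Ax e e0.
have [d1 d10 h1] := cg _ (AB x Ax) e e0; have [d d0 h] := cf x Ax d1 d10.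
by exists d => // y Ay xy; apply: h1; [exact: AB|exact: h].
Qed.

Lemma continuous_affine (R : realType) (V : normedModType R) (a b : V) :
  continuous (fun r : R^o => a + r *: b).
Proof.
move=> x; apply: (@continuousD R V R^o (fun=> a) (fun r => r *: b)); first exact: cvg_cst.
by apply: (@continuousZ R); [exact: cvg_id|exact: cvg_cst].
Qed.

Lemma continuous_scale_shift (R : realType) (V : normedModType R) (a : V) (r : R) :
  continuous (fun x : V => a + r *: x).
Proof.
move=> x; apply: (@continuousD R V V (fun=> a) (fun x => r *: x)); first exact: cvg_cst.
by apply: continuousZ; [exact: cvg_cst|exact: cvg_id].
Qed.

Lemma invariance_of_domain (R : realType) (n : nat)
    (f : 'rV[R]_n.+1 -> 'rV[R]_n.+1) (a : 'rV[R]_n.+1) (r : R) : 0 < r ->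
  {within [set x : 'rV[R]_n.+1 | `|x - a| <= r], continuous f} ->
  (forall x y : 'rV[R]_n.+1, `|x - a| <= r -> `|y - a| <= r -> f x = f y -> x = y) ->
  exists2 d : R, 0 < d & forall y : 'rV[R]_n.+1, `|y - f a| < d ->
    exists2 x : 'rV[R]_n.+1, `|x - a| <= r & f x = y.
Proof.
move=> r0 cf fI; pose V : normedModType R := 'rV[R]_n.+1.
pose s (x : V) : V := a + r *: x.
have sr (x : V) : (`|s x - a| <= r) = (`|x| <= 1).
  by rewrite /s addrAC subrr add0r normrZ gtr0_norm // -[X in _ <= X]mulr1 ler_pM2l.
have cs : continuous s by exact: continuous_scale_shift.
have [||d d0 dP] := @invariance_of_domain_unit R n (f \o s).
- apply: (@within_continuous_comp R V V V _ _ s f _ cf).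
    exact: (@continuous_subspaceT V V).
  by move=> x /= x1; rewrite sr.
- move=> x y x1 y1 /= fxy; have : s x = s y by apply: fI; rewrite ?sr.
  by move=> /addrI /(scalerI (lt0r_neq0 r0)).
exists d => // y; have -> : f a = (f \o s) 0 by rewrite /= /s scaler0 addr0.
by move=> /dP[x x1 fx]; exists (s x); rewrite ?sr.
Qed.

(** Invariance of domain applies to [k \o sg], and the injectivity of k brings the covered
    neighbourhood back to Y. Nothing else about the shape of Y is needed. *)
Lemma sheet_nbhd (R : realType) (m d : nat) (Y : set 'rV[R]_m)
    (k : 'rV[R]_m -> 'rV[R]_d.+1) (sg : 'rV[R]_d.+1 -> 'rV[R]_m) (r : R) :
  {within Y, continuous k} -> (forall x y, Y x -> Y y -> k x = k y -> x = y) ->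
  0 < r -> {within [set u : 'rV[R]_d.+1 | `|u| <= r], continuous sg} ->
  (forall u v : 'rV[R]_d.+1, `|u| <= r -> `|v| <= r -> sg u = sg v -> u = v) ->
  (forall u : 'rV[R]_d.+1, `|u| <= r -> Y (sg u)) ->
  exists2 e : R, 0 < e & forall y, Y y -> `|y - sg 0| < e ->
    exists2 u : 'rV[R]_d.+1, `|u| <= r & sg u = y.
Proof.
move=> ck kI r0 cs sI sY.
have eS : [set x : 'rV[R]_d.+1 | `|x - 0| <= r] = [set u | `|u| <= r].
  by apply/seteqP; split=> u /=; rewrite subr0.
have s0 : Y (sg 0) by apply: sY; rewrite normr0 ltW.
have [||e e0 eP] := @invariance_of_domain R d (k \o sg) 0 r r0.
- rewrite eS; exact: (@within_continuous_comp R _ _ _ _ Y sg k cs ck).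
- by move=> x y; rewrite !subr0 => xr yr /kI h; apply: sI => //; apply: h; exact: sY.
have [e1 e10 e1P] := (@within_continuousP R _ _ Y k).1 ck _ s0 e e0.
exists e1 => // y Yy ye; have [] := eP (k y).
  by rewrite distrC; apply: e1P => //; rewrite distrC.
by move=> u; rewrite subr0 => ur /kI h; exists u => //; apply: h => //; exact: sY.
Qed.

(** * Meshes near the barycenter of a facet *)

Section MeshCoordinates.
Variables (R : realType) (m d : nat).
Implicit Types (F K : {fset 'rV[R]_m}) (N : mesh R m d.+1).

Lemma card_opposite_facet N F K z :
  K \in mesh_elts N -> z \in K -> F = (K `\ z)%fset -> #|` F| = d.+1.
Proof.
move=> KN zK FE; have [cK _] := mesh_simplex KN.
by have := cardfsD1 z K; rewrite zK -FE cK => /succn_inj.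
Qed.

Lemma affine_coords_uniq K (c c' : 'rV[R]_m -> R) : affinely_independent K ->
  \sum_(p <- K) c p = \sum_(p <- K) c' p ->
  \sum_(p <- K) c p *: p = \sum_(p <- K) c' p *: p ->
  forall p, p \in K -> c p = c' p.
Proof.
move=> aK e1 e2 p pK; apply/eqP; rewrite -subr_eq0; apply/eqP; move: p pK.
apply: (aK (fun p => c p - c' p)); first by rewrite sumrB e1 subrr.
by under eq_bigr do rewrite scalerBl; rewrite sumrB e2 subrr.
Qed.

(** The common point lies in the hull of the intersection of K and K', so both families of weights
    are the one over that intersection, extended by 0. *)
Lemma mesh_coords_uniq N K K' (c c' : 'rV[R]_m -> R) :
  K \in mesh_elts N -> K' \in mesh_elts N ->
  (forall p, p \in K -> 0 <= c p) -> (forall p, p \in K' -> 0 <= c' p) ->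
  \sum_(p <- K) c p = 1 -> \sum_(p <- K') c' p = 1 ->
  \sum_(p <- K) c p *: p = \sum_(p <- K') c' p *: p ->
  forall p, (if p \in K then c p else 0) = (if p \in K' then c' p else 0).
Proof.
move=> KN KN' c0 c0' c1 c1' cc'.
have : hull (K `&` K')%fset (\sum_(p <- K) c p *: p).
  by rewrite -(mesh_hullI KN KN'); split; [exists c|exists c'].
move=> [e [e0 e1 eE]].
have key L (b : 'rV[R]_m -> R) : L \in mesh_elts N -> (K `&` K' `<=` L)%fset ->
    \sum_(p <- L) b p = 1 ->
    \sum_(p <- L) b p *: p = \sum_(p <- (K `&` K')%fset) e p *: p ->
    forall p, (if p \in L then b p else 0) = (if p \in (K `&` K')%fset then e p else 0).
  move=> LN sL b1 bE p; have [pL|pL] := boolP (p \in L); last first.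
    by case: ifP => // /(fsubsetP sL); rewrite (negbTE pL).
  have [_ aL] := mesh_simplex LN.
  apply: (affine_coords_uniq aL (c := b)
    (c' := fun p => if p \in (K `&` K')%fset then e p else 0)) => //.
    by rewrite sum_fsub // b1 e1.
  rewrite bE -(sum_fsub _ sL); apply: eq_bigr => q _.
  by case: ifP; rewrite ?scale0r.
move=> p; rewrite (key K) //; last exact: fsubsetIl.
by rewrite (key K') ?fsubsetIr // -cc' -eE.
Qed.

(** A general f covers both the sum of the weights and the weighted sum of the points;
    [inord (index y F)] recovers the position of a vertex in F. *)
Lemma sum_cone (V : zmodType) F K z (t : 'I_d.+1 -> R) (w : R)
    (f : R -> 'rV[R]_m -> V) : #|` F| = d.+1 -> z \in K -> F = (K `\ z)%fset ->
  \sum_(y <- K) f (if y == z then w else t (inord (index y F))) y =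
  f w z + \sum_i f (t i) (nth 0 F i).
Proof.
move=> cF zK FE; rewrite (big_fsetD1 z) //= eqxx -FE; congr (_ + _).
rewrite (big_nth 0) (_ : size F = d.+1) // big_mkord; apply: eq_bigr => i _.
have iF : (i < size F)%N by rewrite (_ : size F = d.+1).
have aF : nth 0 F i \in F by exact: mem_nth.
rewrite ifN; first by rewrite index_uniq ?fset_uniq // inord_val.
by apply: contraTneq aF => ->; rewrite FE !inE eqxx.
Qed.

(** If the apexes differ, neither is a vertex of the other element, so [mesh_coords_uniq] gives both
    of them weight 0. *)
Lemma cone_coords_uniq N F K K' z z' (t t' : 'I_d.+1 -> R) (w w' : R) :
  K \in mesh_elts N -> K' \in mesh_elts N -> z \in K -> z' \in K' ->
  F = (K `\ z)%fset -> F = (K' `\ z')%fset ->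
  (forall i, 0 <= t i) -> (forall i, 0 <= t' i) -> 0 <= w -> 0 <= w' ->
  w + \sum_i t i = 1 -> w' + \sum_i t' i = 1 ->
  w *: z + \sum_i t i *: nth 0 F i = w' *: z' + \sum_i t' i *: nth 0 F i ->
  t =1 t' /\ (if z == z' then w = w' else w = 0 /\ w' = 0).
Proof.
move=> KN KN' zK zK' FE FE' t0 t0' w0 w0' s1 s1' e.
have cF := card_opposite_facet KN zK FE.
pose c y := if y == z then w else t (inord (index y F)).
pose c' y := if y == z' then w' else t' (inord (index y F)).
have h p : (if p \in K then c p else 0) = (if p \in K' then c' p else 0).
  apply: (mesh_coords_uniq KN KN').
  - by move=> y _; rewrite /c; case: ifP.
  - by move=> y _; rewrite /c'; case: ifP.
  - by rewrite (sum_cone t w (fun x _ => x) cF zK FE).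
  - by rewrite (sum_cone t' w' (fun x _ => x) cF zK' FE').
  - rewrite (sum_cone t w (fun x y => x *: y) cF zK FE).
    by rewrite (sum_cone t' w' (fun x y => x *: y) cF zK' FE').
have zF : z \notin F by rewrite FE !inE eqxx.
have zF' : z' \notin F by rewrite FE' !inE eqxx.
split=> [i|].
  have iF : (i < size F)%N by rewrite (_ : size F = d.+1).
  have aF : nth 0 F i \in F by exact: mem_nth.
  have := h (nth 0 F i).
  have : nth 0 F i \in K by apply: (fsubsetP _ _ aF); rewrite FE fsubD1set.
  have : nth 0 F i \in K' by apply: (fsubsetP _ _ aF); rewrite FE' fsubD1set.
  move=> -> ->; rewrite /c /c' !ifN.
  - by rewrite index_uniq ?fset_uniq // inord_val.
  - by apply: contraNneq zF' => <-.
  - by apply: contraNneq zF => <-.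
case: eqVneq => [zz'|nz].
  by have := h z; rewrite zK zz' zK' /c /c' !eqxx zz' eqxx.
have zK'n : z \in K' = false.
  by apply/negbTE; move: zF; rewrite FE' !inE nz.
have zKn : z' \in K = false.
  by apply/negbTE; move: zF'; rewrite FE !inE eq_sym nz.
split; first by have := h z; rewrite zK zK'n /c eqxx.
by have := h z'; rewrite zK' zKn /c' eqxx.
Qed.

Lemma hull_cone N F K z (t : 'I_d.+1 -> R) (w : R) :
  K \in mesh_elts N -> z \in K -> F = (K `\ z)%fset ->
  (forall i, 0 <= t i) -> 0 <= w -> w + \sum_i t i = 1 ->
  hull K (w *: z + \sum_i t i *: nth 0 F i).
Proof.
move=> KN zK FE t0 w0 s1.
have cF := card_opposite_facet KN zK FE.
exists (fun y => if y == z then w else t (inord (index y F))); split.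
- by move=> y _; case: ifP.
- by rewrite (sum_cone t w (fun x _ => x) cF zK FE).
- by rewrite (sum_cone t w (fun x y => x *: y) cF zK FE).
Qed.

End MeshCoordinates.

Definition barycenter (R : realType) (m : nat) (F : {fset 'rV[R]_m}) : 'rV[R]_m :=
  #|` F|%:R^-1 *: \sum_(p <- F) p.

Lemma continuous_fold_expr (R : realType) (V W : normedModType R) (k : nat)
    (h : V -> R^o) (c : 'I_k.+1 -> V -> R^o) (a : 'I_k.+1 -> W) (p q : W) :
  continuous h -> (forall i, continuous (c i)) ->
  continuous (fun u => Num.max (h u) 0 *: p + Num.max (- h u) 0 *: q +
    \sum_i ((1 - `|h u : R| - h u) / k.+1%:R + c i u) *: a i).
Proof.
move=> ch cc.
have cn : continuous (fun u => `|h u| : R^o) by move=> u; exact: (cvg_norm (ch u)).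
have cN : continuous (fun u => - h u : R^o).
  by move=> u; apply: (@continuousN R R^o V); exact: ch.
have c0 (b : R^o) : continuous (fun _ : V => b) by move=> u; exact: cvg_cst.
have cb (b : W) : continuous (fun _ : V => b) by move=> u; exact: cvg_cst.
have cp (g : V -> R^o) (b : W) : continuous g ->
    continuous (fun u => Num.max (g u) 0 *: b).
  move=> cg u; apply: (@continuousZ R W V (fun u => Num.max (g u) 0) (fun=> b)).
    by apply: (@continuous_max R V g (fun=> 0)); [exact: cg|exact: c0].
  exact: cb.
have cw i : continuous (fun u => (1 - `|h u : R| - h u) / k.+1%:R + c i u : R^o).
  move=> u; apply: (@continuousD R R^o V
    (fun u => (1 - `|h u : R| - h u) / k.+1%:R) (c i)); last exact: cc.
  apply: (@continuousM R V (fun u => 1 - `|h u : R| - h u) (fun=> k.+1%:R^-1)).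
    apply: (@continuousB R R^o V (fun u => 1 - `|h u : R|) h); last exact: ch.
    by apply: (@continuousB R R^o V (fun=> 1)); [exact: c0|exact: cn].
  exact: c0.
move=> u; apply: (@continuousD R W V (fun u => Num.max (h u) 0 *: p +
  Num.max (- h u) 0 *: q)); last exact: (continuous_row_sum cw).
by apply: (@continuousD R W V (fun u => Num.max (h u) 0 *: p)); exact: cp.
Qed.

Section Fold.
Variables (R : realType) (m d : nat) (a : 'I_d.+1 -> 'rV[R]_m) (p q : 'rV[R]_m).
Implicit Types u v : 'rV[R]_d.+1.

(** The d+1 coordinates of u carry two data: their sum is a signed height over the facet, and their
    differences move the point along it. *)
Definition fold_height u : R := \sum_i u ord0 i.

(** The term common to all i is chosen so that the weights add up to what the apex leaves, 1 -
    |height|. *)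
Definition fold_weight (i : 'I_d.+1) u : R :=
  (1 - `|fold_height u| - fold_height u) / d.+1%:R + u ord0 i.

(* A chart around the barycenter of the facet a that joins the two simplices
   with apexes p and q: the sign of the height selects the simplex. *)
Definition fold u : 'rV[R]_m :=
  Num.max (fold_height u) 0 *: p + Num.max (- fold_height u) 0 *: q +
  \sum_i fold_weight i u *: a i.

Lemma fold_ge0 u : 0 <= fold_height u ->
  fold u = fold_height u *: p + \sum_i fold_weight i u *: a i.
Proof. by move=> h; rewrite /fold max_l // max_r ?oppr_le0 // scale0r addr0. Qed.

Lemma fold_le0 u : fold_height u <= 0 ->
  fold u = - fold_height u *: q + \sum_i fold_weight i u *: a i.
Proof. by move=> h; rewrite /fold max_r // max_l ?oppr_ge0 // scale0r add0r. Qed.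

Lemma sum_fold_weight u : `|fold_height u| + \sum_i fold_weight i u = 1.
Proof.
rewrite big_split /= -/(fold_height u) sumr_const card_ord.
rewrite -(mulr_natr (_ / _)) divfK ?pnatr_eq0 //.
by ring.
Qed.

(** On this ball |height| <= 1/4, so the common term is at least 1/(2(d+1)), while a coordinate is
    at least -1/(4(d+1)). *)
Lemma fold_weight_ge0 u i : `|u| <= (4 * d.+1%:R)^-1 -> 0 <= fold_weight i u.
Proof.
set r := _^-1 => ur.
have d0 : 0 < d.+1%:R :> R by rewrite ltr0n.
have rE : r * d.+1%:R = 4^-1 by rewrite /r invfM divfK // gt_eqF.
have uj j : `|u ord0 j| <= r by exact: le_trans (rV_coord_le _ _) ur.
have : `|fold_height u| <= 4^-1.
  rewrite -rE /fold_height (le_trans (ler_norm_sum _ _ _)) //.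
  rewrite (le_trans (ler_sum _ (fun j _ => uj j))) //.
  by rewrite sumr_const card_ord mulr_natr.
have := uj i; rewrite /fold_weight; set s := fold_height u; move=> ui s4.
rewrite -(pmulr_lge0 _ d0) mulrDl divfK ?gt_eqF //.
have : - r * d.+1%:R <= u ord0 i * d.+1%:R.
  by rewrite ler_pM2r //; move: ui; rewrite ler_norml => /andP[].
have := ler_norm s; rewrite mulNr rE; move: s4; move: (`|s|) (u ord0 i * _) => x y.
lra.
Qed.

Lemma fold_weight_inj u v : fold_height u = fold_height v ->
  (forall i, fold_weight i u = fold_weight i v) -> u = v.
Proof.
move=> huv tuv; apply/rowP => i; have := tuv i.
by rewrite /fold_weight huv => /addrI.
Qed.

Lemma fold_height_continuous : continuous (fold_height : 'rV[R]_d.+1 -> R^o).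
Proof.
apply: (@continuous_sum R 'rV[R]_d.+1 R^o) => i; exact: continuous_coord.
Qed.

Lemma fold_continuous : continuous fold.
Proof.
apply: (@continuous_fold_expr R 'rV[R]_d.+1 'rV[R]_m) => [|i].
  exact: fold_height_continuous.
exact: continuous_coord.
Qed.

Lemma fold0 : fold 0 = d.+1%:R^-1 *: \sum_i a i.
Proof.
have h0 : fold_height 0 = 0 by rewrite /fold_height big1 // => i _; rewrite mxE.
rewrite fold_ge0 h0 // scale0r add0r scaler_sumr; apply: eq_bigr => i _.
by rewrite /fold_weight h0 normr0 !subr0 mxE addr0 mul1r.
Qed.

End Fold.

Lemma sum_barycenter (R : realType) (m d : nat) (F : {fset 'rV[R]_m}) :
  #|` F| = d.+1 -> barycenter F = \sum_(i < d.+1) d.+1%:R^-1 *: nth 0 F i.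
Proof.
move=> cF; rewrite /barycenter cF scaler_sumr (big_nth 0).
by rewrite (_ : size F = d.+1) // big_mkord.
Qed.

Lemma facet_not_in_three (R : realType) (m d : nat) (N : mesh R m d.+1)
    (F K1 K2 K3 : {fset 'rV[R]_m}) (U : set 'rV[R]_m) (k : 'rV[R]_m -> 'rV[R]_d.+1) :
  K1 \in mesh_elts N -> K2 \in mesh_elts N -> K3 \in mesh_elts N ->
  is_facet F K1 -> is_facet F K2 -> is_facet F K3 ->
  K1 != K2 -> K1 != K3 -> K2 != K3 ->
  open U -> U (barycenter F) ->
  {within mesh_support N `&` U, continuous k} ->
  (forall x y, (mesh_support N `&` U) x -> (mesh_support N `&` U) y ->
    k x = k y -> x = y) -> False.
Proof.
move=> KN1 KN2 KN3 /is_facet_pred1[p pK1 FE1] /is_facet_pred1[q qK2 FE2]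
  /is_facet_pred1[w wK3 FE3] n12 n13 n23 oU Ux ck kI.
have cF := card_opposite_facet KN1 pK1 FE1.
have pq : p != q.
  by apply: contraNneq n12 => pq; rewrite -(fsetD1K pK1) -(fsetD1K qK2) -FE1 -FE2 pq.
have pw : w != p.
  by apply: contraNneq n13 => wp; rewrite -(fsetD1K pK1) -(fsetD1K wK3) -FE1 -FE3 wp.
have qw : w != q.
  by apply: contraNneq n23 => wq; rewrite -(fsetD1K qK2) -(fsetD1K wK3) -FE2 -FE3 wq.
pose a (i : 'I_d.+1) : 'rV[R]_m := nth 0 F i.
pose sg := fold a p q.
have sg0 : sg 0 = barycenter F by rewrite /sg fold0 (sum_barycenter cF) scaler_sumr.
have csg : continuous sg by exact: fold_continuous.
have [r1 r10 r1P] : exists2 r : R, 0 < r & forall u : 'rV[R]_d.+1, `|u| < r -> U (sg u).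
  have : \forall u \near (0 : 'rV[R]_d.+1), U (sg u).
    apply: csg; rewrite sg0; apply: open_nbhs_nbhs; exact.
  move=> /nbhs_normP[r r0 rP]; exists r => // u ur; apply: rP.
  by rewrite /= sub0r normrN.
pose r := Num.min (r1 / 2) (4 * d.+1%:R)^-1.
have r0 : 0 < r by rewrite lt_min divr_gt0 // invr_gt0 mulr_gt0.
have rr1 (u : 'rV[R]_d.+1) : `|u| <= r -> `|u| < r1.
  rewrite le_min => /andP[u1 _]; apply: (le_lt_trans u1).
  by rewrite ltr_pdivrMr // ltr_pMr // ltr1n.
have tw (u : 'rV[R]_d.+1) i : `|u| <= r -> 0 <= fold_weight i u.
  by rewrite le_min => /andP[_ u2]; exact: fold_weight_ge0.
have tsum (u : 'rV[R]_d.+1) := sum_fold_weight u.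
have sgS (u : 'rV[R]_d.+1) : `|u| <= r -> (mesh_support N `&` U) (sg u).
  move=> ur; split; last exact/r1P/rr1.
  have [h|/ltW h] := leP 0 (fold_height u).
    exists K1 => //; rewrite /sg fold_ge0 //; apply: (hull_cone KN1 pK1 FE1) => // [i|].
      exact: tw.
    by rewrite -[in X in X + _](ger0_norm h) tsum.
  exists K2 => //; rewrite /sg fold_le0 //; apply: (hull_cone KN2 qK2 FE2) => // [i||].
  - exact: tw.
  - by rewrite oppr_ge0.
  - by rewrite -(ler0_norm h) tsum.
(* If the heights have opposite signs, the common point lies in F and both heights vanish. *)
have sgI (u v : 'rV[R]_d.+1) : `|u| <= r -> `|v| <= r -> sg u = sg v -> u = v.
  move=> ur vr; have tu := fun i => tw u i ur; have tv := fun i => tw v i vr.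
  have := tsum u; have := tsum v.
  have [hu|/ltW hu] := leP 0 (fold_height u);
      have [hv|/ltW hv] := leP 0 (fold_height v).
  - rewrite !ger0_norm // => sv su; rewrite /sg !fold_ge0 // => e.
    have [tt] := cone_coords_uniq KN1 KN1 pK1 pK1 FE1 FE1 tu tv hu hv su sv e.
    by rewrite eqxx => hh; exact: fold_weight_inj.
  - rewrite (ger0_norm hu) (ler0_norm hv) => sv su.
    rewrite /sg fold_ge0 // fold_le0 // => e.
    have hv' : 0 <= - fold_height v by rewrite oppr_ge0.
    have [tt] := cone_coords_uniq KN1 KN2 pK1 qK2 FE1 FE2 tu tv hu hv' su sv e.
    rewrite (negbTE pq) => -[h1 /eqP]; rewrite oppr_eq0 => /eqP h2.
    by apply: fold_weight_inj => //; rewrite h1 h2.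
  - rewrite (ger0_norm hv) (ler0_norm hu) => sv su.
    rewrite /sg [in X in X = _]fold_le0 // fold_ge0 // => e.
    have hu' : 0 <= - fold_height u by rewrite oppr_ge0.
    have [tt] := cone_coords_uniq KN2 KN1 qK2 pK1 FE2 FE1 tu tv hu' hv su sv e.
    rewrite eq_sym (negbTE pq) => -[/eqP + h2]; rewrite oppr_eq0 => /eqP h1.
    by apply: fold_weight_inj => //; rewrite h1 h2.
  - rewrite !ler0_norm // => sv su; rewrite /sg !fold_le0 // => e.
    have hu' : 0 <= - fold_height u by rewrite oppr_ge0.
    have hv' : 0 <= - fold_height v by rewrite oppr_ge0.
    have [tt] := cone_coords_uniq KN2 KN2 qK2 qK2 FE2 FE2 tu tv hu' hv' su sv e.
    by rewrite eqxx => /oppr_inj hh; exact: fold_weight_inj.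
have [e e0 eP] := sheet_nbhd ck kI r0 (continuous_subspaceT csg) sgI sgS.
(* These points of K3 head for its apex w, on which they have weight t; the sheet over K1 and K2
   puts no weight on w. *)
pose y (t : R) : 'rV[R]_m := barycenter F + t *: (w - barycenter F).
have [t [t0 t1 yt Uyt]] : exists t : R, [/\ 0 < t, t < 1, `|y t - sg 0| < e & U (y t)].
  have cy : continuous (y : R^o -> 'rV[R]_m) by exact: continuous_affine.
  have y0 : y 0 = barycenter F by rewrite /y scale0r addr0.
  have H1 : \forall t \near (0 : R^o), U (y t).
    by apply: cy; rewrite y0; apply: open_nbhs_nbhs.
  have H2 : \forall t \near (0 : R^o), `|y t - sg 0| < e.
    by have /cvgrPdistC_lt/(_ e e0) := cy 0; rewrite y0 sg0.
  have [t2 t20 tP] := (nbhs_normP _ _).1 (filterI H1 H2); rewrite /= in t20.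
  pose t := Num.min (t2 / 2) 2^-1.
  have t0 : 0 < t.
    by rewrite lt_min; apply/andP; split; [exact: divr_gt0|rewrite invr_gt0].
  have [] := tP t.
    rewrite /= sub0r normrN gtr0_norm //; apply: (@le_lt_trans _ _ (t2 / 2)).
      by rewrite ge_min lexx.
    by rewrite ltr_pdivrMr // ltr_pMr // ltr1n.
  exists t; split=> //; apply: (@le_lt_trans _ _ 2^-1).
    by rewrite ge_min lexx orbT.
  by rewrite invf_lt1 // ltr1n.
pose c (_ : 'I_d.+1) : R := (1 - t) / d.+1%:R.
have yE : y t = t *: w + \sum_i c i *: a i.
  rewrite /y (sum_barycenter cF) scalerBr addrCA; congr (_ + _).
  rewrite -[X in X - _]scale1r -scalerBl scaler_sumr.
  by apply: eq_bigr => i _; rewrite scalerA.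
have c0 i : 0 <= c i by rewrite divr_ge0 // subr_ge0 ltW.
have cs : t + \sum_i c i = 1.
  by rewrite sumr_const card_ord -(mulr_natr (_ / _)) divfK ?pnatr_eq0 // subrKC.
have [|u ur uy] := eP (y t) _ yt.
  split=> //; exists K3 => //; rewrite yE.
  by apply: (hull_cone KN3 wK3 FE3) => //; exact: ltW.
have tu := fun i => tw u i ur; have := tsum u.
move: uy; have [hu|/ltW hu] := leP 0 (fold_height u).
  rewrite ger0_norm // /sg fold_ge0 // yE => /esym ee su.
  have [_] := cone_coords_uniq KN3 KN1 wK3 pK1 FE3 FE1 c0 tu (ltW t0) hu cs su ee.
  by rewrite (negbTE pw) => -[tE _]; move: t0; rewrite tE ltxx.
rewrite ler0_norm // /sg fold_le0 // yE => /esym ee su.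
have hu' : 0 <= - fold_height u by rewrite oppr_ge0.
have [_] := cone_coords_uniq KN3 KN2 wK3 qK2 FE3 FE2 c0 tu (ltW t0) hu' cs su ee.
by rewrite (negbTE qw) => -[tE _]; move: t0; rewrite tE ltxx.
Qed.

Lemma local_embedding_non_branching (R : realType) (m d : nat) (N : mesh R m d.+1) :
  (forall F, F \in mesh_facets N ->
    exists (U : set 'rV[R]_m) (k : 'rV[R]_m -> 'rV[R]_d.+1),
    [/\ open U, U (barycenter F), {within mesh_support N `&` U, continuous k} &
        forall x y, (mesh_support N `&` U) x -> (mesh_support N `&` U) y ->
          k x = k y -> x = y]) ->
  non_branching N.
Proof.
move=> H; apply/allP => F FN; rewrite leqNgt; apply/negP => c3.
have [U [k [oU Ux ck kI]]] := H F FN.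
(* All elements have the same size, so inclusion of F already makes it a facet. *)
have fK K : K \in elts_containing N F -> K \in mesh_elts N /\ is_facet F K.
  rewrite !inE /= => /andP[KN FK]; split=> //.
  move: FN => /mesh_facetsP[K0 K0N /and3P[F0 _ /eqP cF]].
  have [cK _] := mesh_simplex KN; have [cK0 _] := mesh_simplex K0N.
  by rewrite /is_facet F0 FK cF cK0 cK eqxx.
set E := elts_containing N F in c3 fK.
pose e i := nth fset0 E i.
have eE i : (i < 3)%N -> e i \in E by move=> i3; apply/mem_nth/(leq_trans i3).
have eN i j : (i < 3)%N -> (j < 3)%N -> i != j -> e i != e j.
  move=> i3 j3; rewrite /e nth_uniq ?fset_uniq //; exact: leq_trans c3.
have [N0 F0] := fK _ (eE 0%N isT); have [N1 F1] := fK _ (eE 1%N isT).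
have [N2 F2] := fK _ (eE 2%N isT).
exact: (facet_not_in_three N0 N1 N2 F0 F1 F2 (eN 0%N 1%N isT isT isT)
  (eN 0%N 2%N isT isT isT) (eN 1%N 2%N isT isT isT) oU Ux ck kI).
Qed.

(** * Boundary facets in a chart *)

Lemma closed_ge_fun (R : realType) (T : topologicalType) (f : T -> R^o) (c : R) :
  continuous f -> closed [set x | c <= f x].
Proof. by move=> /continuous_closedP cf; exact: (cf _ (@closed_ge R c)). Qed.

Lemma closed_eq_fun (R : realType) (T : topologicalType) (f : T -> R^o) (c : R) :
  continuous f -> closed [set x | f x = c].
Proof. by move=> /continuous_closedP cf; exact: (cf _ (@closed_eq R c)). Qed.

(** The hull is the continuous image of the standard simplex of weights, which is closed in a
    cube. *)
Lemma compact_hull (R : realType) (m : nat) (A : {fset 'rV[R]_m}) : compact (hull A).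
Proof.
pose k := #|` A|; pose a (i : 'I_k) : 'rV[R]_m := nth 0 A i.
pose lin (c : 'rV[R]_k) : 'rV[R]_m := \sum_i c ord0 i *: a i.
pose P := [set c : 'rV[R]_k | (forall i, 0 <= c ord0 i) /\ \sum_i c ord0 i = 1].
have -> : hull A = lin @` P.
  apply/seteqP; split=> [x [c [c0 c1 ->]]|x [c [c0 c1] <-]].
    exists (\row_i c (a i)); last first.
      rewrite /lin (big_nth 0) big_mkord; apply: eq_bigr => i _.
      by rewrite mxE.
    split=> [i|]; first by rewrite mxE c0 // mem_nth.
    by rewrite -c1 (big_nth 0) big_mkord; apply: eq_bigr => i _; rewrite mxE.
  (* [inord] needs a nonempty index type; for empty A no weights sum to 1. *)
  case k0 : k => [|k'] in a lin P c c0 c1 *.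
    by move: c1; rewrite big_ord0 => /esym/eqP; rewrite oner_eq0.
  have ia (i : 'I_k'.+1) : index (a i) A = i.
    by rewrite index_uniq ?fset_uniq // (_ : size A = k'.+1).
  exists (fun p => c ord0 (inord (index p A))); split.
  - by move=> p _; exact: c0.
  - rewrite (big_nth 0) (_ : size A = k'.+1) // big_mkord -[RHS]c1; apply: eq_bigr => i _.
    by rewrite ia inord_val.
  - rewrite [RHS](big_nth 0) (_ : size A = k'.+1) // big_mkord; apply: eq_bigr => i _.
    by rewrite ia inord_val.
have cl : continuous lin.
  have := @continuous_row_sum R 'rV[R]_k 'rV[R]_m k (fun i c => c ord0 i) a
    (@continuous_coord R k).
  exact.
apply: continuous_compact; first exact: continuous_subspaceT.
apply: (subclosed_compact _ (@compact_cube R k 0 1)).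
  pose V : normedModType R := 'rV[R]_k.
  have -> : P = (\bigcap_(i in setT) [set c : V | 0 <= c ord0 i]) `&`
                [set c : V | \sum_i c ord0 i = 1].
    apply/seteqP; split=> c [c0 c1]; split=> // i; first by move=> _; exact: c0.
    exact: c0.
  apply: closedI.
    apply: closed_bigI => i _; apply: (@closed_ge_fun R V (fun c => c ord0 i)).
    exact: continuous_coord.
  apply: (@closed_eq_fun R V (fun c => \sum_i c ord0 i)).
  by apply: (@continuous_sum R V R^o) => i; exact: continuous_coord.
move=> c [c0 c1] /=; rewrite subr0; apply: rV_norm_le => // i.
rewrite ger0_norm // -c1 (bigD1 i) //= lerDl.
by apply: sumr_ge0 => j _.
Qed.

Section BarycentricChart.
Variables (R : realType) (m d : nat) (K : {fset 'rV[R]_m}) (p0 : 'rV[R]_m).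
Hypotheses (sK : is_simplex d K) (p0K : p0 \in K).

Let L := (K `\ p0)%fset.

Let cL : size L = d.
Proof. by case: sK => + _; rewrite (cardfsD1 p0) p0K => /succn_inj. Qed.

Let b (j : 'I_d) : 'rV[R]_m := nth 0 L j.

Let jL (j : 'I_d) : (j < size L)%N.
Proof. by rewrite cL. Qed.

Let bL j : b j \in L.
Proof. exact: mem_nth (jL j). Qed.

Let edges : 'M[R]_(d, m) := \matrix_j (b j - p0).

Let sum_cone0 (V : zmodType) (f : 'rV[R]_m -> V) :
  \sum_(p <- K) f p = f p0 + \sum_j f (b j).
Proof.
rewrite (big_fsetD1 p0) //=; congr (_ + _).
by rewrite (big_nth 0) cL big_mkord.
Qed.

(** A linear relation between edges is an affine relation between vertices once p0 receives minus
    the sum of the coefficients. *)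
Lemma row_free_edges : row_free edges.
Proof.
apply: inj_row_free => v; rewrite mulmx_sum_row => vE.
pose c p := if p == p0 then - \sum_j v ord0 j else
  \sum_j (if b j == p then v ord0 j else 0).
have bp0 j : b j == p0 = false by apply: contraTF (bL j) => /eqP->; rewrite !inE eqxx.
have cb j : c (b j) = v ord0 j.
  rewrite /c bp0 (bigD1 j) //= eqxx big1 ?addr0 // => i ij.
  by rewrite (nth_uniq _ (jL i) (jL j) (fset_uniq _)) (inj_eq val_inj) (negbTE ij).
have [_ aK] := sK; apply/rowP => j; rewrite mxE -cb; apply: aK.
- rewrite sum_cone0 /c eqxx -/c; under [X in _ + X]eq_bigr do rewrite -/(c _) cb.
  by rewrite addNr.
- rewrite sum_cone0; under [X in _ + X]eq_bigr do rewrite cb.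
  rewrite {1}/c eqxx scaleNr addrC scaler_suml -sumrB -[RHS]vE.
  by apply: eq_bigr => i _; rewrite rowK scalerBr.
- by have := bL j; rewrite !inE => /andP[].
Qed.

(** The edge matrix has a right inverse, so an affine map on all of the ambient space reads off the
    barycentric coordinates other than that of p0. *)
Lemma barycentric_chart : exists kap : 'rV[R]_m -> 'rV[R]_d,
  continuous kap /\ forall c : 'rV[R]_m -> R, \sum_(p <- K) c p = 1 ->
    kap (\sum_(p <- K) c p *: p) = \row_j c (nth 0 (K `\ p0)%fset j).
Proof.
have /row_freeP[B AB] := row_free_edges.
exists (fun x => - (p0 *m B) + x *m B); split.
  move=> x; apply: (@continuousD R 'rV[R]_d 'rV[R]_m (fun=> - (p0 *m B))
    (fun x => x *m B)).
    exact: cst_continuous.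
  exact: continuous_mulmx.
move=> c c1; rewrite addrC -mulmxBl.
have -> : \sum_(p <- K) c p *: p - p0 = (\row_j c (b j)) *m edges.
  rewrite mulmx_sum_row -[X in _ - X]scale1r -c1 scaler_suml -sumrB.
  under eq_bigr do rewrite -scalerBr.
  rewrite sum_cone0 subrr scaler0 add0r.
  by apply: eq_bigr => j _; rewrite rowK mxE.
by rewrite -mulmxA AB mulmx1.
Qed.

End BarycentricChart.

Lemma boundary_facet_unique (R : realType) (m n : nat) (M : mesh R m n)
    (F K K' : {fset 'rV[R]_m}) : F \in boundary_facets M ->
  K \in mesh_elts M -> (F `<=` K)%fset -> K' \in mesh_elts M -> (F `<=` K')%fset ->
  K = K'.
Proof.
rewrite !inE /= => /andP[_ /cardfs1P[L LE]] KM FK KM' FK'.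
have : K \in elts_containing M F by rewrite !inE /= KM FK.
have : K' \in elts_containing M F by rewrite !inE /= KM' FK'.
by rewrite LE !inE => /eqP -> /eqP ->.
Qed.

Section BoundaryPoints.
Variables (R : realType) (m n : nat) (M : mesh R m n.+1).
Local Notation X := (mesh_support M).

(** The other elements are closed and miss the point: by [mesh_coords_uniq], an element through it
    contains every vertex of F, and K is the only one that does. *)
Lemma boundary_facet_nbhd F K (c : 'rV[R]_m -> R) : F \in boundary_facets M ->
  K \in mesh_elts M -> is_facet F K -> (forall p, p \in F -> 0 < c p) ->
  \sum_(p <- F) c p = 1 ->
  \forall x \near \sum_(p <- F) c p *: p, X x -> hull K x.
Proof.
move=> FB KM /and3P[_ FK _] c0 c1; set y := \sum_(p <- F) _.
have notin K' : K' \in mesh_elts M -> K' != K -> ~ hull K' y.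
  move=> KM' nK [c' [c0' c1' yE]]; case/eqP: nK; apply/esym.
  apply: (boundary_facet_unique FB KM FK KM'); apply/fsubsetP => p pF.
  have sumF := @sum_fsub R m _ F K.
  have e : forall q, (if q \in K then if q \in F then c q else 0 else 0) =
                     (if q \in K' then c' q else 0).
    apply: (mesh_coords_uniq KM KM') => // [q _||].
    - by case: ifP => // /c0/ltW.
    - by rewrite sumF.
    - rewrite -yE /y -sumF //; apply: eq_bigr => q _.
      by case: ifP => //; rewrite scale0r.
  have := e p; rewrite pF (fsubsetP FK) //; case: ifP => // _ cp.
  by have := c0 p pF; rewrite cp ltxx.
have : \forall x \near y, (\bigcap_(K' in [set` mesh_elts M])
    [set x | K' != K -> ~ hull K' x]) x.
  apply: (@filter_bigI _ _ (mesh_elts M) (fun K' => [set x | K' != K -> ~ hull K' x])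
    _ (nbhs_filter y)) => K' KM'.
  have [->|nK] := eqVneq K' K; first by apply: filterS filterT.
  have oC : open (~` hull K').
    apply: closed_openC.
    exact: compact_closed (@norm_hausdorff R 'rV[R]_m) (@compact_hull R m K').
  have : nbhs y (~` hull K') by apply: open_nbhs_nbhs; split=> //; exact: notin.
  by apply: filterS => x xK _.
apply: filterS => x xP [K' KM' xK'].
have [<-//|nK] := eqVneq K' K; by have := xP K' KM' nK.
Qed.

Variables (U : set 'rV[R]_m) (V : set 'rV[R]_n.+1).
Variables (h : 'rV[R]_m -> 'rV[R]_n.+1) (g : 'rV[R]_n.+1 -> 'rV[R]_m).
Hypotheses (oU : open U) (oV : open V).
Local Notation H := (@half_space R n.+1).
Hypothesis hP : forall x, (X `&` U) x -> (H `&` V) (h x) /\ g (h x) = x.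
Hypothesis gP : forall z, (H `&` V) z -> (X `&` U) (g z) /\ h (g z) = z.
Hypothesis ch : {within X `&` U, continuous h}.
Hypothesis cg : {within H `&` V, continuous g}.

Lemma half_space_ge0 z : H z <-> 0 <= z ord0 ord0.
Proof.
split=> [|z0 i i0]; first exact.
by rewrite (_ : i = ord0) //; apply: val_inj.
Qed.

(* Otherwise g, read in the barycentric coordinates of the only element K that
   contains F, would be an open map into a half-space through a point of its
   boundary. *)
Lemma chart_open_boundary_facet F (c : 'rV[R]_m -> R) : F \in boundary_facets M ->
  (forall p, p \in F -> 0 < c p) -> \sum_(p <- F) c p = 1 ->
  U (\sum_(p <- F) c p *: p) -> h (\sum_(p <- F) c p *: p) ord0 ord0 = 0.
Proof.
move=> FB c0 c1 Uy; have [K KM fF] := boundary_facetsP FB.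
have near_y := boundary_facet_nbhd FB KM fF c0 c1.
have sK := mesh_simplex KM; have /and3P[F0 FK _] := fF.
have [z zK FE] := is_facet_pred1 fF.
(* The omitted vertex p0 is taken in F, so that [kap] records the coordinate of z, the vertex
   opposite to F: it is 0 on F and nonnegative on K. *)
have [p0 p0F] := fset0Pn _ F0.
have p0K : p0 \in K := fsubsetP FK _ p0F.
have z0 : z != p0 by apply: contraTneq p0F => <-; rewrite FE !inE eqxx.
have [kap [ckap kapE]] := barycentric_chart sK p0K.
have zL : z \in (K `\ p0)%fset by rewrite !inE z0.
have cL : size (K `\ p0)%fset = n.+1.
  by case: sK => + _; rewrite (cardfsD1 p0) p0K => /succn_inj.
have zi : (index z (K `\ p0)%fset < n.+1)%N by rewrite -cL index_mem.
pose j0 := Ordinal zi.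
have nthz : nth 0 (K `\ p0)%fset j0 = z by rewrite nth_index.
set y := \sum_(p <- F) c p *: p in Uy near_y *.
have yK : y = \sum_(p <- K) (if p \in F then c p else 0) *: p.
  rewrite /y -(sum_fsub _ FK); apply: eq_bigr => q _.
  by case: ifP => //; rewrite scale0r.
have kapy : kap y ord0 j0 = 0.
  rewrite yK kapE ?sum_fsub // mxE nthz ifN //.
  by rewrite FE !inE eqxx.
have kap_ge0 x : hull K x -> 0 <= kap x ord0 j0.
  by move=> [e [e0 e1 ->]]; rewrite kapE // mxE nthz e0.
have kap_inj x x' : hull K x -> hull K x' -> kap x = kap x' -> x = x'.
  move=> [e [e0 e1 ->]] [e' [e0' e1' ->]]; rewrite !kapE // => /rowP ee.
  have eL q : q \in (K `\ p0)%fset -> e q = e' q.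
    move=> qL; have qi : (index q (K `\ p0)%fset < n.+1)%N by rewrite -cL index_mem.
    by have := ee (Ordinal qi); rewrite !mxE nth_index.
  have ep0 : e p0 = e' p0.
    have eLL := eq_big_seq (op := +%R) (idx := 0) _ eL.
    have := etrans e1 (esym e1').
    by rewrite !(big_fsetD1 p0 p0K) /= eLL => /addIr.
  apply: eq_big_seq => q qK; congr (_ *: _).
  by have [->//|qp] := eqVneq q p0; apply: eL; rewrite !inE qp.
have Xy : X y.
  by exists K => //; apply: hullS FK _ _; exists c; split=> // p /c0/ltW.
have [[Hy Vy] ghy] := hP (conj Xy Uy).
have hy0 := (half_space_ge0 (h y)).1 Hy.
apply/eqP; rewrite eq_le hy0 andbT leNgt; apply/negP => hy.
(* As [h y] has positive first coordinate, a full ball around it lies in the half-space; if small,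
   it is sent by g close to y, hence into K. *)
have [r r0 rP] : exists2 r : R, 0 < r &
    forall z, `|z - h y| <= r -> (H `&` V) z /\ hull K (g z).
  have [e e0 eP] := (nbhs_normP _ _).1 near_y.
  have [r1 r10 r1P] := (@within_continuousP R _ _ _ g).1 cg _ (conj Hy Vy) e e0.
  have : nbhs (h y) V by exact: open_nbhs_nbhs.
  move=> /nbhs_normP[r2 r20 r2P]; rewrite /= in r20.
  pose r := Num.min (Num.min r1 r2) (h y ord0 ord0) / 2.
  have r0 : 0 < r by rewrite divr_gt0 // !lt_min r10 r20 hy.
  have rlt z' : `|z' - h y| <= r ->
      [/\ `|h y - z'| < r1, `|h y - z'| < r2 & `|h y - z'| < h y ord0 ord0].
    rewrite distrC => zr; have : `|h y - z'| < r * 2.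
      by apply: (le_lt_trans zr); rewrite ltr_pMr // ltr1n.
    by rewrite /r divfK // !lt_min => /andP[/andP[-> ->] ->].
  exists r => // z' /rlt[zr1 zr2 zr3].
  have HVz : (H `&` V) z'.
    split; last exact: r2P.
    apply/half_space_ge0; have := le_lt_trans (rV_coord_le (h y - z') ord0) zr3.
    by rewrite !mxE ltr_norml => /andP[_]; rewrite ltrBlDr ltrDl => /ltW.
  split=> //; have [[Xg _] _] := gP HVz; apply: eP => //=.
  by rewrite -ghy; apply: r1P.
have [||e e0 eP] := @invariance_of_domain R n (kap \o g) (h y) r r0.
- apply: (@within_continuous_comp R _ _ _ _ setT); last by [].
    by apply: continuous_subspaceW cg => z' /rP[].
  exact: continuous_subspaceT.
- move=> z1 z2 /rP[HV1 K1] /rP[HV2 K2] /kap_inj => /(_ K1 K2) e.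
  by rewrite -(gP HV1).2 -(gP HV2).2 e.
(* The coordinate j0 of v is negative, yet v is among the values of [kap] on K that invariance of
   domain provides. *)
pose v : 'rV[R]_n.+1 := kap y - (e / 2) *: delta_mx ord0 j0.
have [|z' zr kz] := eP v.
  rewrite /= ghy /v addrAC subrr add0r normrN normrZ.
  have -> : `|delta_mx ord0 j0 : 'rV[R]_n.+1| = 1.
    apply/eqP; rewrite eq_le; apply/andP; split.
      apply: rV_norm_le => // i; rewrite mxE eqxx /=.
      by case: (i == j0); rewrite ?normr1 ?normr0 // ler01.
    by have := rV_coord_le (delta_mx ord0 j0 : 'rV[R]_n.+1) j0; rewrite mxE !eqxx normr1.
  by rewrite mulr1 gtr0_norm ?divr_gt0 // ltr_pdivrMr // ltr_pMr // ltr1n.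
have [_ Kgz] := rP _ zr; have := kap_ge0 _ Kgz.
rewrite -[kap (g z')]/((kap \o g) z') kz /v !mxE kapy !eqxx mulr1 sub0r.
by rewrite oppr_ge0 leNgt divr_gt0.
Qed.

(** Sliding y towards the barycenter makes all weights positive, so y is a limit of points covered
    by [chart_open_boundary_facet], and h is continuous. *)
Lemma chart_boundary_facet F y : F \in boundary_facets M -> hull F y -> U y ->
  h y ord0 ord0 = 0.
Proof.
move=> FB [c [c0 c1 yE]] Uy; have [K KM fF] := boundary_facetsP FB.
have /and3P[F0 FK _] := fF.
have Xy : X y by exists K => //; apply: hullS FK _ _; exists c.
have F1 : 0 < #|` F|%:R :> R by rewrite ltr0n cardfs_gt0.
pose ct (t : R) p := c p + t * (#|` F|%:R^-1 - c p).
have ct1 t : \sum_(p <- F) ct t p = 1.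
  rewrite big_split /= -mulr_sumr sumrB c1 big_const_seq count_predT iter_addr_0.
  by rewrite -[_ *+ _]mulr_natr mulVf ?gt_eqF // subrr mulr0 addr0.
have ctE t : \sum_(p <- F) ct t p *: p = y + t *: (barycenter F - y).
  under eq_bigr do rewrite scalerDl -scalerA scalerBl.
  rewrite big_split /= -yE; congr (_ + _).
  by rewrite -scaler_sumr sumrB -yE -scaler_sumr.
have ct0 t p : 0 < t -> t <= 1 -> p \in F -> 0 < ct t p.
  move=> t0 t1 pF; have cp := c0 p pF.
  have -> : ct t p = (1 - t) * c p + t * #|` F|%:R^-1 by rewrite /ct; ring.
  by rewrite ltr_wpDl ?mulr_ge0 ?subr_ge0 ?mulr_gt0 ?invr_gt0.
apply/eqP/negPn/negP => hn; have hy : 0 < `|h y ord0 ord0| by rewrite normr_gt0.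
have [e e0 eP] := (@within_continuousP R _ _ _ h).1 ch _ (conj Xy Uy) _ hy.
pose yt (t : R) : 'rV[R]_m := y + t *: (barycenter F - y).
have cy : continuous (yt : R^o -> 'rV[R]_m) by exact: continuous_affine.
have y0 : yt 0 = y by rewrite /yt scale0r addr0.
have H1 : \forall t \near (0 : R^o), U (yt t).
  by apply: cy; rewrite y0; apply: open_nbhs_nbhs.
have H2 : \forall t \near (0 : R^o), `|y - yt t| < e.
  by have /cvgrPdist_lt/(_ e e0) := cy 0; rewrite y0.
have [t2 t20 tP] := (nbhs_normP _ _).1 (filterI H1 H2); rewrite /= in t20.
pose t := Num.min (t2 / 2) 1.
have t0 : 0 < t by rewrite lt_min; apply/andP; split; [exact: divr_gt0|exact: ltr01].
have t1 : t <= 1 by rewrite ge_min lexx orbT.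
have [|Ut yte] := tP t.
  rewrite /= sub0r normrN gtr0_norm //; apply: (@le_lt_trans _ _ (t2 / 2)).
    by rewrite ge_min lexx.
  by rewrite ltr_pdivrMr // ltr_pMr // ltr1n.
have ht : h (yt t) ord0 ord0 = 0.
  rewrite /yt -ctE; apply: chart_open_boundary_facet => // [p|].
    exact: ct0.
  by rewrite ctE.
have Xt : X (yt t).
  exists K => //; apply: hullS FK _ _; exists (ct t); split=> // p pF.
  exact/ltW/ct0.
have := eP _ (conj Xt Ut) yte; rewrite ltNge => /negP; apply.
by have := rV_coord_le (h y - h (yt t)) ord0; rewrite !mxE ht subr0.
Qed.

End BoundaryPoints.

(** * Non-branching of a regular mesh and of its boundary *)

Lemma hull_barycenter (R : realType) (m : nat) (F : {fset 'rV[R]_m}) :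
  F != fset0 -> hull F (barycenter F).
Proof.
move=> F0; have F1 : 0 < #|` F|%:R :> R by rewrite ltr0n cardfs_gt0.
exists (fun=> #|` F|%:R^-1); split=> [p _||].
- by rewrite invr_ge0 ltW.
- by rewrite big_const_seq count_predT iter_addr_0 -[_ *+ _]mulr_natr mulVf ?gt_eqF.
- by rewrite /barycenter scaler_sumr.
Qed.

Lemma mesh_facet_support (R : realType) (m n : nat) (M : mesh R m n)
    (F : {fset 'rV[R]_m}) : F \in mesh_facets M -> mesh_support M (barycenter F).
Proof.
move=> /mesh_facetsP[K KM /and3P[F0 FK _]]; exists K => //.
exact: hullS FK _ (hull_barycenter F0).
Qed.

Lemma boundary_support (R : realType) (m n : nat) (M : mesh R m n.+1) :
  mesh_support (mesh_boundary M) `<=` mesh_support M.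
Proof.
move=> x [F FB xF]; have [K KM /and3P[_ FK _]] := boundary_facetsP FB.
by exists K => //; exact: hullS FK _ xF.
Qed.

(** A chart into the half-space is a local embedding in Euclidean space, at interior and boundary
    points alike. *)
Lemma regular_non_branching (R : realType) (m n : nat) (M : mesh R m n.+1) :
  regular M -> non_branching M.
Proof.
move=> Mreg; apply: local_embedding_non_branching => F FM.
have [U [V [oU Ux _ [h [g [hP _ ch _]]]]]] := Mreg _ (mesh_facet_support FM).
exists U, h; split=> // x y /hP[_ gx] /hP[_ gy] hxy.
by rewrite -gx hxy.
Qed.

Lemma regular_boundary_non_branching (R : realType) (m n : nat) (M : mesh R m n.+1) :
  regular M -> non_branching (mesh_boundary M).
Proof.
case: n M => [|d] M Mreg.
  (* The boundary has dimension 0 here, and a 0-simplex has no facets. *)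
  apply/allP => S /mesh_facetsP[F FB /and3P[S0 _ /eqP cS]].
  have [cF _] := mesh_simplex FB; move: cS; rewrite cF => -[] /eqP.
  by rewrite cardfs_eq0 (negbTE S0).
apply: local_embedding_non_branching => S SB.
have xB := mesh_facet_support SB.
have [U [V [oU Ux oV [h [g [hP gP ch cg]]]]]] := Mreg _ (boundary_support xB).
have sub : mesh_support (mesh_boundary M) `&` U `<=` mesh_support M `&` U.
  by move=> x [/boundary_support].
have h0 x : (mesh_support (mesh_boundary M) `&` U) x -> h x ord0 ord0 = 0.
  move=> [[F FB xF] Uxx].
  exact: (chart_boundary_facet oU oV hP gP ch cg FB xF Uxx).
(* Coordinate 0 of h vanishes on the boundary, so the map that drops it is still injective. *)
exists U, (fun x => \row_i h x ord0 (lift ord0 i)); split=> //.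
  apply/within_continuousP => x Bx e e0.
  have [r r0 rP] := (@within_continuousP R _ _ _ h).1 ch x (sub _ Bx) e e0.
  exists r => // y By xy; apply: rV_norm_lt => // i; rewrite !mxE.
  apply: le_lt_trans (rP y (sub _ By) xy).
  by have := rV_coord_le (h x - h y) (lift ord0 i); rewrite !mxE.
move=> x y Bx By /rowP hxy.
have [_ gx] := hP _ (sub _ Bx); have [_ gy] := hP _ (sub _ By).
rewrite -gx -gy; congr g; apply/rowP => i.
have [->|i0] := eqVneq i ord0; first by rewrite !h0.
rewrite eq_sym in i0; have [j -> _] := unlift_some i0.
by have := hxy j; rewrite !mxE.
Qed.

(** * Turning around a ridge *)

(** Distinct sets of equal size meet in a strictly smaller set, which S therefore fills. This is the
    equation that [repr_adj] asks for. *)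
Lemma facet_setI (R : realType) (m : nat) (S F F' : {fset 'rV[R]_m}) :
  is_facet S F -> is_facet S F' -> F != F' -> S = (F `&` F')%fset.
Proof.
move=> /and3P[_ SF /eqP cF] /and3P[_ SF' /eqP cF'] nF.
apply/eqP; rewrite eqEfcard fsubsetI SF SF' /= -ltnS cF.
apply: fproper_ltn_card; rewrite fproperEneq fsubsetIl andbT.
apply: contraNneq nF => FI; rewrite eqEfcard -cF -cF' leqnn andbT -FI.
exact: fsubsetIr.
Qed.

Section Turn.
Variables (R : realType) (m n : nat) (G : gmesh R m n.+1).
Local Notation split_facet := ({fset 'rV[R]_m} * gm_elt G)%type.
Implicit Types (S F : {fset 'rV[R]_m}) (k : gm_elt G) (x y : split_facet).

(** The other facet is obtained by removing the vertex of F outside S. *)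
Lemma other_facet_ex k S F : is_facet F (gm_real k) -> is_facet S F ->
  exists F', other_facet k S F F'.
Proof.
move=> fF fS; have [p pK FE] := is_facet_pred1 fF; have [q qF SE] := is_facet_pred1 fS.
have /and3P[_ FK _] := fF; have qK : q \in gm_real k := fsubsetP FK _ qF.
have pq : p != q by apply: contraTneq qF => <-; rewrite FE !inE eqxx.
exists (gm_real k `\ q)%fset; apply/and3P; split.
- apply/and3P; split; last by rewrite (cardfsD1 q (gm_real k)) qK.
    by apply/fset0Pn; exists p; rewrite !inE pq.
  exact: fsubD1set.
- by rewrite SE; apply: fsetSD.
- by apply: contraTneq qF => <-; rewrite !inE eqxx.
Qed.

Lemma gm_turn_end S x y : gm_turn S x y ->
  is_facet y.1 (gm_real y.2) /\ gm_nbr y.2 y.1 = None.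
Proof. by elim=> // F k F' /and3P[]. Qed.

Definition turn_step S x y : Prop :=
  other_facet x.2 S x.1 y.1 /\ gm_nbr x.2 y.1 = Some y.2.

(** The walk is reversible: adjacency is symmetric and the other facet through S is unique, so the
    predecessor is determined. *)
Lemma turn_step_inj S x x' y :
  is_facet x.1 (gm_real x.2) -> is_facet S x.1 ->
  is_facet x'.1 (gm_real x'.2) -> is_facet S x'.1 ->
  turn_step S x y -> turn_step S x' y -> x = x'.
Proof.
case: x x' y => [F k] [F' k'] [F1 k1] /= fF SF fF' SF' [/= o b] [/= o' b'].
move: (gm_nbr_sym b); rewrite (gm_nbr_sym b') => -[kk]; rewrite kk in o' fF'.
have [fF1 SF1] := other_facet_facet fF SF o.
have /and3P[_ sF _] := SF; have /and3P[_ sF' _] := SF'.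
rewrite (other_facet_uniq fF1 SF1 (other_facet_sym fF sF o)
  (other_facet_sym fF' sF' o')).
by rewrite kk.
Qed.

(* The walk is injective and cannot come back to its first split facet, which
   has no neighbour; as there are finitely many split facets, it stops. *)
Lemma gm_turn_ex S x : is_facet x.1 (gm_real x.2) -> is_facet S x.1 ->
  gm_nbr x.2 x.1 = None -> exists y, gm_turn S x y.
Proof.
move=> fx Sx bx; apply: contrapT => nt.
pose I y := [/\ is_facet y.1 (gm_real y.2), is_facet S y.1 & ~ exists z, gm_turn S y z].
(* The condition [I y] stands under the existential so that choice yields a total map to iterate. *)
have next y : exists z, I y -> turn_step S y z /\ I z.
  have [Iy|nI] := pselect (I y); last by exists y.
  have [fy Sy ny] := Iy; case: y fy Sy ny Iy => F k /= fF SF ny _.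
  have [F' o] := other_facet_ex fF SF.
  have [fF' SF'] := other_facet_facet fF SF o.
  case b : (gm_nbr k F') => [k'|]; last first.
    by case: ny; exists (F', k); apply: gm_turn_stop.
  exists (F', k') => _; split=> //; split=> //=; first by have [] := gm_nbr_facet b.
  by move=> [z t]; apply: ny; exists z; apply: gm_turn_step t.
have [f fP] := choice next.
have Ix i : I (iter i f x).
  by elim: i => [|i IH] /=; [split|have [] := fP _ IH].
have step i : turn_step S (iter i f x) (iter i.+1 f x) by have [] := fP _ (Ix i).
(* Injectivity pulls a repetition back to index 0, where the starting facet would have a neighbour,
   against [bx]. *)
have ninj i j : iter i f x = iter (i + j.+1) f x -> False.
  elim: i => [|i IH] e.
    have [_] := step j; rewrite -(add0n j.+1) -e /= => /gm_nbr_sym.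
    by rewrite bx.
  apply: IH; have [f1 S1 _] := Ix i; have [f2 S2 _] := Ix (i + j.+1)%N.
  by apply: (turn_step_inj f1 S1 f2 S2 (step i)); rewrite e; exact: step.
pose N := #|` split_facets G|.
have : uniq [seq iter i f x | i <- iota 0 N.+1].
  rewrite map_inj_in_uniq ?iota_uniq // => i j _ _ e.
  have [ij|ji|//] := ltngtP i j.
    by case: (ninj i (j - i.+1)%N); rewrite -addSnnS subnKC.
  by case: (ninj j (i - j.+1)%N); rewrite -addSnnS subnKC.
move=> us; have := uniq_leq_size us (s2 := split_facets G).
rewrite size_map size_iota ltnn => h; apply: notF; apply: h.
by move=> _ /mapP[i _ ->]; rewrite in_split_facets; have [] := Ix i.
Qed.

End Turn.

(** Any other element that contains F meets k exactly in F, by size, and is thus a neighbour; so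
    having none means that k alone contains F. *)
Lemma gmesh_of_nbrN (R : realType) (m n : nat) (M : mesh R m n)
    (nbM : non_branching M) (F : {fset 'rV[R]_m}) (k : mesh_elts M) :
  is_facet F (val k) ->
  (forall k' : mesh_elts M, ~~ repr_adj (F, k) (F, k')) <-> F \in boundary_facets M.
Proof.
move=> fF; have /and3P[F0 FK /eqP cF] := fF; split=> [nadj|FB k'].
  rewrite !inE /=; apply/andP; split.
    by apply/mesh_facetsP; exists (val k) => //; apply: valP.
  apply/cardfs1P; exists (val k); apply/fsetP => K; rewrite !inE /=.
  apply/andP/eqP => [[KM FK']|->]; last by split=> //; apply: valP.
  apply/eqP/negPn/negP => nK; have := nadj [` KM]%fset; apply/negP/negPn.
  have [cK _] := mesh_simplex KM; have [ck _] := mesh_simplex (valP k).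
  have fK : is_facet F K by rewrite /is_facet F0 FK' cF cK ck eqxx.
  apply/and5P; split=> //=; first by rewrite -val_eqE /= eq_sym.
  by apply/eqP/facet_setI => //; rewrite eq_sym.
apply/negP => /and5P[/= _ nk _ _ /and3P[_ FK' _]]; case/eqP: nk; apply: val_inj.
exact: boundary_facet_unique FB (valP k) FK (valP k') FK'.
Qed.

Theorem lemma3p5 (R : realType) (m n : nat) (M : mesh R m n.+1)
    (Mreg : regular M) :
  exists (nbM : non_branching M) (nbB : non_branching (mesh_boundary M)),
    is_relabeling (gmesh_boundary (gmesh_of nbM)) (gmesh_of nbB).
Proof.
pose nbM := regular_non_branching Mreg.
pose nbB := regular_boundary_non_branching Mreg.
exists nbM, nbB; pose G := gmesh_of nbM.
have nbrN F (k : gm_elt G) : is_facet F (gm_real k) ->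
    gm_nbr k F = None <-> F \in boundary_facets M.
  move=> fF; rewrite -(gmesh_of_nbrN nbM fF) /gm_nbr; case: pickP => [k' adj|nadj].
    by split=> // /(_ k'); rewrite [repr_adj _ _]adj.
  by split=> // _ k'; apply/negbT/nadj.
have bsfB (f : boundary_split_facets G) : (val f).1 \in boundary_facets M.
  by have [fF bF] := bsf_facet f; apply/(nbrN _ _ fF).
pose phi (f : boundary_split_facets G) : mesh_elts (mesh_boundary M) :=
  [` bsfB f]%fset.
(* [phi] forgets the element, which is recovered as the only one that contains the boundary
   facet. *)
have phi_inj : injective phi.
  move=> f f' /(congr1 val) /= e; apply: val_inj.
  have [/and3P[_ FK _] _] := bsf_facet f; have [/and3P[_ FK' _] _] := bsf_facet f'.
  rewrite -e in FK'; rewrite [LHS]surjective_pairing [RHS]surjective_pairing -e.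
  congr pair; apply: val_inj.
  exact: boundary_facet_unique (bsfB f) (valP (val f).2) FK (valP (val f').2) FK'.
have phi_surj (F : mesh_elts (mesh_boundary M)) : exists f, phi f = F.
  have [K KM fF] := boundary_facetsP (valP F).
  pose k : gm_elt G := [` KM]%fset.
  have kB : (val F, k) \in boundary_split_facets G.
    rewrite in_boundary_split_facets /= fF; apply/eqP/(nbrN _ k fF); exact: valP.
  by exists [` kB]%fset; apply: val_inj.
have [psi phiK] := choice phi_surj.
exists phi; split=> //.
  by exists psi => // f; apply: phi_inj; rewrite phiK.
(* Neighbours are distinct, hence by [phi_inj] they are distinct facets of M through F, and
   [facet_setI] applies. *)
have adj F f f' : @gm_adj _ _ _ (gmesh_boundary G) (F, f) (F, f') ->
    @gm_adj _ _ _ (gmesh_of nbB) (F, phi f) (F, phi f').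
  move=> a; have [/= fS fS'] := gm_adj_split a; have [_ /= nf] := gm_adj_facet a.
  have nphi : phi f != phi f' by rewrite (inj_eq phi_inj).
  apply/and5P; split=> //=; apply/eqP/facet_setI => //.
move=> S f f'; apply/idP/idP => [|a]; first exact: adj.
have [/= fS _] := gm_adj_split a.
have [fF bF] := bsf_facet f.
have [y t] := gm_turn_ex fF fS bF.
have [fy by_] := gm_turn_end t.
have yB : y \in boundary_split_facets G.
  by rewrite in_boundary_split_facets fy by_ eqxx.
have ay : @gm_adj _ _ _ (gmesh_boundary G) (S, f) (S, [` yB]%fset).
  by apply/and3P; split=> //=; apply/asboolP.
by have /(congr1 snd)/= /phi_inj -> := gm_adj_deg a (adj _ _ _ ay).
Qed.
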